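(* Fix $W>0$. Let $q\in\mathbb N$, let $\Xi\subset\mathbb R^q$ be nonempty and compact, and let $g_0:\mathbb R\to\mathbb R$, $A:\Xi\to\mathbb R$ and $B:\Xi\to(0,\infty)$ be known, with $A$ and $B$ continuous. Consider $$y_{t+1}=g_0(y_t)+A(\xi)\phi_{B(\xi)}(y_t)+u_t+w_{t+1},\qquad t\ge0,\ \xi\in\Xi,$$ with disturbances satisfying $\sup_{t\ge1}|w_t|\le W$, and put $H(\xi)=(A(\xi),B(\xi))$. The following statements hold. (i) If $\sup_{\xi\in\Xi}B(\xi)\le3\sqrt3/2$, then the system is robustly stabilizable over $\Xi$. (ii) Let $\xi_0$ be an interior point of $\Xi$. Suppose that $A$ and $B$ are continuously differentiable near $\xi_0$, that $\operatorname{rank}DH(\xi_0)=2$, and that $B(\xi_0)\ge3\sqrt3/2$. Then there is no compact neighborhood $K\subset\Xi$ with $\xi_0\in\operatorname{int}K$ over which the system is robustly stabilizable. (iii) If $B(\Xi)$ is finite and $\sup_{\xi\in\Xi}B(\xi)<4$, then the system is robustly stabilizable over $\Xi$. Moreover, in each of parts (i) and (iii), there is a feedback law such that, for every $Y\ge0$, the state is bounded uniformly over $\xi\in\Xi$, all $|y_0|\le Y$, and all disturbance sequences with $\sup_{t\ge1}|w_t|\le W$; that is, the supremum of $|y_t|$ over all these and all $t\ge0$ is finite.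
   Context: For $b>0$ and $y\in\mathbb R$, $\phi_b(y)=\operatorname{sgn}(y)|y|^b$ (so $\phi_b(0)=0$). The state is $y_t\in\mathbb R$, the input is $u_t\in\mathbb R$, and the true parameter $\xi$ is unknown to the controller and constant in time. A feedback law is a sequence $\mu=(\mu_t)_{t\ge0}$ of maps $\mu_t:\mathbb R^{t+1}\to\mathbb R$ (no regularity required) with $u_t=\mu_t(y_0,\ldots,y_t)$; it may depend on the prescribed parameter set, on $W$ and on the known functions $g_0,A,B$, but not on the true parameter or the disturbances. For a nonempty compact set $K\subset\Xi$, the system is robustly stabilizable over $K$ if there is a feedback law such that $\sup_{t\ge0}|y_t|<\infty$ for every true parameter $\xi\in K$, every $y_0\in\mathbb R$, and every disturbance sequence with $\sup_{t\ge1}|w_t|\le W$. *)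

(* Defs.v *)
From HB Require Import structures.
From mathcomp Require Import all_boot all_order all_algebra.
From mathcomp Require Import all_classical all_reals all_analysis.

Set Implicit Arguments.
Unset Strict Implicit.
Unset Printing Implicit Defensive.

Import Order.TTheory GRing.Theory Num.Theory.
Import numFieldNormedType.Exports.

Local Open Scope classical_set_scope.
Local Open Scope ring_scope.

Definition phi (R : realType) (b y : R) : R := Num.sg y * `|y| `^ b.

Definition feedback (R : realType) := forall t : nat, 'rV[R]_t.+1 -> R.

(* Only w 1, w 2, ... enter the dynamics; w 0 is unconstrained. *)
Definition admissible_disturbance (R : realType) (W : R) (w : nat -> R) : Prop :=
  forall t : nat, (1 <= t)%N -> `|w t| <= W.

(* For given mu, xi, w, every initial state y 0 has exactly one such y. *)
Definition closed_loop (R : realType) (q : nat) (g0 : R -> R)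
    (A B : 'rV[R]_q -> R) (mu : feedback R) (xi : 'rV[R]_q) (w y : nat -> R) : Prop :=
  forall t : nat,
    y t.+1 = g0 (y t) + A xi * phi (B xi) (y t)
             + mu t (\row_(i < t.+1) y i) + w t.+1.

Definition robustly_stabilizable (R : realType) (q : nat) (W : R) (g0 : R -> R)
    (A B : 'rV[R]_q -> R) (K : set 'rV[R]_q) : Prop :=
  exists mu : feedback R,
    forall (xi : 'rV[R]_q) (w y : nat -> R),
      K xi -> admissible_disturbance W w -> closed_loop g0 A B mu xi w y ->
      has_ubound (range (fun t : nat => `|y t|)).

(* The law mu is chosen before the bound Y on the initial state. *)
Definition uniformly_robustly_stabilizable (R : realType) (q : nat) (W : R)
    (g0 : R -> R) (A B : 'rV[R]_q -> R) (K : set 'rV[R]_q) : Prop :=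
  exists mu : feedback R,
    forall Y : R, 0 <= Y ->
      has_ubound [set r : R | exists (xi : 'rV[R]_q) (w y : nat -> R) (t : nat),
        [/\ K xi, admissible_disturbance W w, closed_loop g0 A B mu xi w y,
            `|y 0%N| <= Y & r = `|y t|]].

(* Differentiable on a neighborhood of x, with z |-> Df(z) continuous there;
   in finite dimension this continuity may be tested on each direction v. *)
Definition continuously_differentiable_near (R : realType) (q : nat)
    (f : 'rV[R]_q -> R) (x : 'rV[R]_q) : Prop :=
  \forall z \near x, differentiable f z /\
    forall v : 'rV[R]_q, {for z, continuous (fun p => 'D_v f p)}.

Definition Hmap (R : realType) (q : nat) (A B : 'rV[R]_q -> R) (xi : 'rV[R]_q) :
    'rV[R]_2 :=
  \row_(i < 2) (if i == ord0 then A xi else B xi).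

(* Main.v *)
Require Import Defs.
From HB Require Import structures.
From mathcomp Require Import all_boot all_order all_algebra.
From mathcomp Require Import all_classical all_reals all_analysis.
From mathcomp Require Import ring lra.

Set Implicit Arguments.
Unset Strict Implicit.
Unset Printing Implicit Defensive.

Import Order.TTheory GRing.Theory Num.Theory.
Import numFieldNormedType.Exports.

Local Open Scope classical_set_scope.
Local Open Scope ring_scope.

(** On the scale x = ln max(1, |y|) the unknown term a phi_b(y) is an exponential
    a e^(bx), so the question is how well an exponential observed to within W at
    earlier points can be predicted at a new point.

    Stabilization.  The controller cancels the prediction of any model compatible
    with the past (certainty_equivalence).  The true model and the chosen one differ
    by D(x) = a e^(bx) - a' e^(b'x), which is bounded at every earlier point, and the
    next state has about the size of D at the present point.
    - If b is known, then D(x) = e^(b(x - x_s)) D(x_s), whence x_{t+1} is at most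
      about b (x_t - x_s) for every earlier s.  Sustained growth by the factor rho
      requires rho <= b (1 - 1/rho), impossible for b < 4.
    - If b is unknown, two visited points lo < hi are needed.  Lagrange interpolation
      in the span of e^(bx), e^(b'x) (expdiff_lagrange) bounds D(x) by about
      e^(bm (x - lo)), where bm bounds all exponents.  Now sustained growth requires
      rho <= bm (1 - 1/rho^2), impossible for bm < 3 sqrt 3 / 2, which is the minimum
      of rho^3 / (rho^2 - 1) and is attained at rho = sqrt 3.

    Laws for two classes of models combine (switching): as long as the data are
    compatible with the first class, the trajectory is one of that class, hence
    bounded; once they are not, the second law starts afresh.  Applied repeatedly this
    treats finitely many exponents.  It also treats the critical exponent
    bm = 3 sqrt 3 / 2 (critical_stabilizable).  Given y_0, the law for the known
    exponent bm keeps the state in a bounded region, on which all exponents in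
    [bm - eps, bm] look like bm up to a bounded extra noise.  If the data contradict
    bm nevertheless, then b <= bm - eps and the subcritical law takes over.

    Instability (adversary_wins).  When the state is at x_t, the last measurement was
    made at x_{t-1}.  The adversary tilts its current line ln a + b x about the point
    over x_{t-1}, one way or the other, so that the next state is large whatever the
    input, and so little that the older measurements are still met within W.  The one
    at x_{t-2} limits the tilt most, to about e^(- b x_{t-2}), so x_{t+1} is at least
    about b (x_t - x_{t-2}), and for b > 3 sqrt 3 / 2 the ratio sqrt 3 sustains itself.
    The lines converge to a true parameter pair, which is realized because (A, B) maps
    every neighborhood of a point of rank two onto a neighborhood of its image
    (image_contains_box). *)

(** * Orbits that can only grow by a bounded ratio *)

(** The growth ratio is measured against an arbitrary earlier value and not the
    preceding one: between two records the state may wander among small values. *)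
Definition descends (R : realType) (x : nat -> R) (n : nat) (rho X : R) :=
  forall s, (s <= n)%N -> X < x s -> exists s', (s' < s)%N /\ x s <= rho * x s'.

(** A value above [X] would start an infinite descent in time. *)
Lemma descends1_bounded (R : realType) (x : nat -> R) (n : nat) (X : R) :
  descends x n 1 X -> forall s, (s <= n)%N -> x s <= X.
Proof.
move=> dx; elim/ltn_ind => s IHs sn; rewrite leNgt; apply/negP => Xs.
have [s' [s's]] := dx s sn Xs; rewrite mul1r => xs.
by have := IHs s' s's (ltnW (leq_trans s's sn)); rewrite leNgt (lt_le_trans Xs xs).
Qed.

Lemma descends_le (R : realType) (x : nat -> R) (n : nat) (rho rho' X : R) :
  (forall t, 0 <= x t) -> rho <= rho' -> descends x n rho X -> descends x n rho' X.
Proof.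
move=> x0 le dx s sn Xs; have [s' [s's xs]] := dx s sn Xs; exists s'; split=> //.
exact: le_trans xs (ler_wpM2r (x0 _) le).
Qed.

(** If every admissible growth ratio can be improved by a fixed amount, then
    finitely many improvements bring it down to 1.  The class [P] of orbits is kept
    fixed throughout, so that the final bound is uniform over [P]. *)
Lemma bounded_by_descent (R : realType) (P : (nat -> R) -> nat -> Prop)
    (rho0 delta : R) (delta_gt0 : 0 < delta)
    (x_ge0 : forall x n, P x n -> forall t, 0 <= x t)
    (base : exists2 X, 0 <= X & forall x n, P x n -> descends x n rho0 X)
    (step : forall rho X, 1 <= rho -> 0 <= X -> exists2 X', 0 <= X' &
       forall x n, P x n -> descends x n rho X -> descends x n (rho - delta) X') :
  exists Bd, forall x n, P x n -> forall s, (s <= n)%N -> x s <= Bd.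
Proof.
suff H N : forall rho X, rho <= 1 + N%:R * delta -> 0 <= X ->
    exists Bd, forall x n, P x n -> descends x n rho X ->
      forall s, (s <= n)%N -> x s <= Bd.
  have [X X0 dX] := base.
  have [N rhoN] : exists N : nat, rho0 <= 1 + N%:R * delta.
    exists (Num.trunc `|rho0 / delta|).+1.
    have /ltW := truncnS_gt `|rho0 / delta|.
    move/(le_trans (ler_norm _)); rewrite ler_pdivrMr// => h.
    by apply: le_trans h _; rewrite lerDr.
  have [Bd HB] := H N rho0 X rhoN X0.
  by exists Bd => x n Px; apply: HB (dX _ _ Px).
elim: N => [|N IHN] rho X rhoN X0.
  exists X => x n Px dx; apply: descends1_bounded.
  by apply: descends_le dx; [exact: x_ge0 Px|rewrite mul0r addr0 in rhoN].
have rho1 : 1 <= 1 + N.+1%:R * delta by rewrite lerDl mulr_ge0// ltW.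
have [X' X'0 dX'] := step _ X rho1 X0.
have [|Bd HB] := IHN (1 + N.+1%:R * delta - delta) X' _ X'0.
  by rewrite -natr1; lra.
exists Bd => x n Px dx; apply: HB => //; apply: dX' => //.
by apply: descends_le dx => //; exact: x_ge0 Px.
Qed.

(** Taking the first time guarantees that the earlier value provided by [descends]
    lies strictly below the level [v]. *)
Lemma first_time_ge (R : realType) (x : nat -> R) (s : nat) (v : R) :
  v <= x s -> exists s0, [/\ (s0 <= s)%N, v <= x s0 & forall i, (i < s0)%N -> x i < v].
Proof.
move=> vs; have ex : exists i, v <= x i by exists s.
case: (ex_minnP ex) => s0 vs0 min; exists s0; split=> //; first exact: min.
by move=> i is0; rewrite ltNge; apply: contraTN is0 => /min; rewrite -leqNgt.
Qed.

(** [rho = b (1 - 1 / rho)] has discriminant [b ^ 2 - 4 b], negative for [0 < b < 4].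
    One [delta] serves all [rho], because for [rho >= b + 1] the margin is at least 1.
    One of the two [delta] pays for additive constants, the other for the decrease of
    the ratio. *)
Lemma known_exponent_margin (R : realType) (b : R) : 0 < b -> b < 4 ->
  exists2 delta : R, 0 < delta & forall rho : R, 1 <= rho -> b * (1 - rho^-1) + 2 * delta <= rho.
Proof.
move=> b0 b4; have b1 : 0 < b + 1 by rewrite addr_gt0.
pose d := b * (1 - b / 4) / (b + 1) / 3.
have q0 : 0 < b * (1 - b / 4) by rewrite mulr_gt0//; lra.
have d0 : 0 < d by rewrite /d !divr_gt0.
exists (Num.min 3^-1 d) => [|rho rho1]; first by rewrite lt_min d0 andbT; lra.
have [m1 m2] : Num.min 3^-1 d <= 3^-1 /\ Num.min 3^-1 d <= d.
  by rewrite ge_min lexx ge_min lexx orbT.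
have r0 : 0 < rho by lra.
have i0 : 0 < rho^-1 by rewrite invr_gt0.
have [rb|rb] := leP (b + 1) rho.
  have : 0 <= b * rho^-1 by rewrite mulr_ge0// ltW.
  by rewrite mulrBr mulr1; lra.
have k : rho - b * (1 - rho^-1) = (rho ^+ 2 - b * rho + b) / rho.
  by field; rewrite gt_eqF.
have : b * (1 - b / 4) / (b + 1) <= rho - b * (1 - rho^-1).
  rewrite k; apply: (@le_trans _ _ (b * (1 - b / 4) / rho)).
    by rewrite ler_wpM2l ?(ltW q0)// lef_pV2 ?posrE// ltW.
  rewrite ler_pM2r ?invr_gt0//.
  have := sqr_ge0 (rho - b / 2); nra.
rewrite -[b * _ / _](@divfK _ 3) -/d; last by lra.
lra.
Qed.

(** [rho ^ 3 - b rho ^ 2 + b] is minimal at [rho = 2 b / 3], with value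
    [b (1 - 4 b ^ 2 / 27)].  Here a third [delta] pays for the linear term [eta * x t] of
    [unknown_exponent_orbit]. *)
Lemma unknown_exponent_margin (R : realType) (b : R) : 0 < b -> 4 * b ^+ 2 < 27 ->
  exists2 delta : R, 0 < delta & forall rho : R, 1 <= rho -> b * (1 - rho^-2) + 3 * delta <= rho.
Proof.
move=> b0 b4; have b1 : 0 < b + 1 by rewrite addr_gt0.
pose d := b * (1 - 4 * b ^+ 2 / 27) / (b + 1) ^+ 2 / 3.
have q0 : 0 < b * (1 - 4 * b ^+ 2 / 27) by rewrite mulr_gt0//; lra.
have d0 : 0 < d by rewrite /d !divr_gt0// exprn_gt0.
exists (Num.min 3^-1 d) => [|rho rho1]; first by rewrite lt_min d0 andbT; lra.
have [m1 m2] : Num.min 3^-1 d <= 3^-1 /\ Num.min 3^-1 d <= d.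
  by rewrite ge_min lexx ge_min lexx orbT.
have r0 : 0 < rho by lra.
have i0 : 0 < rho ^-2 by rewrite invr_gt0 exprn_gt0.
have [rb|rb] := leP (b + 1) rho.
  have : 0 <= b * rho^-2 by rewrite mulr_ge0// ltW.
  by rewrite mulrBr mulr1; lra.
have k : rho - b * (1 - rho^-2) = (rho ^+ 3 - b * rho ^+ 2 + b) / rho ^+ 2.
  by field; rewrite gt_eqF.
have : b * (1 - 4 * b ^+ 2 / 27) / (b + 1) ^+ 2 <= rho - b * (1 - rho^-2).
  rewrite k; apply: (@le_trans _ _ (b * (1 - 4 * b ^+ 2 / 27) / rho ^+ 2)).
    rewrite ler_wpM2l ?(ltW q0)// lef_pV2 ?posrE ?exprn_gt0//.
    by rewrite ler_pXn2r ?nnegrE ?ltW.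
  rewrite ler_pM2r ?invr_gt0 ?exprn_gt0//.
  (* rho^3 - b rho^2 + 4 b^3 / 27 has the double root 2 b / 3 and the root - b / 3. *)
  have : 0 <= (rho - 2 * b / 3) ^+ 2 * (rho + b / 3).
    by rewrite mulr_ge0 ?sqr_ge0//; lra.
  nra.
rewrite -[X in X <= _](@divfK _ 3) -/d; last by lra.
lra.
Qed.

(** What certainty equivalence yields on the logarithmic scale when the exponent [b]
    is known: any single earlier point [x s] limits the next value. *)
Record known_exponent_orbit (R : realType) (b C X0 : R) (x : nat -> R) (n : nat) : Prop := KnownExponentOrbit {
  known_ge0 : forall t, 0 <= x t;
  known_init : x 0%N <= X0;
  known_crude : forall t, (t < n)%N -> x t.+1 <= b * x t + C;
  known_past : forall t s, (t < n)%N -> (s < t)%N ->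
    x t.+1 <= b * Num.max 0 (x t - x s) + C }.

Lemma known_exponent_orbit_bounded (R : realType) (b C X0 : R) : 0 < b -> b < 4 -> 0 <= C -> 0 <= X0 ->
  exists Bd, forall x n, known_exponent_orbit b C X0 x n -> forall s, (s <= n)%N -> x s <= Bd.
Proof.
move=> b0 b4 C0 X00; have [d d0 gap] := known_exponent_margin b0 b4.
apply: (@bounded_by_descent _ _ (b + 1) d) => //.
- by move=> x n [].
- exists (b * C + C + X0) => [|x n [x0 xi crude past] s sn].
    by rewrite !addr_ge0// mulr_ge0// ltW.
  case: s sn => [_|t tn Xt].
    have bC : 0 <= b * C by rewrite mulr_ge0// ltW.
    by move=> Xx; exfalso; lra.
  exists t; split=> //; have := crude t tn.
  have [Ct|tC] := leP C (x t); first by lra.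
  have : b * x t <= b * C by rewrite ler_pM2l// ltW.
  lra.
- move=> rho X rho1 X_0; pose m := X + C / d.
  have Cd : 0 <= C / d by rewrite divr_ge0// ltW.
  have bm : 0 <= b * m by rewrite mulr_ge0 ?(ltW b0)// addr_ge0.
  exists (b * m + C + X0) => [|x n [x0 xi crude past] dx s sn]; first by rewrite !addr_ge0.
  case: s sn => [_ Xx|t tn Xt]; first by exfalso; lra.
  have xm : m < x t.
    rewrite ltNge; apply/negP => h.
    have : b * x t <= b * m by rewrite ler_pM2l.
    by have := crude t tn; lra.
  exists t; split=> //.
  have Xxt : X < x t by apply: le_lt_trans xm; rewrite lerDl.
  have [s1 [s1t xs1]] := dx t (ltnW tn) Xxt.
  apply: le_trans (past t s1 tn s1t) _.
  have r0 : 0 < rho by lra.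
  have hd : C <= d * x t by rewrite mulrC -ler_pdivrMr//; rewrite /m in xm; lra.
  have hg : (b * (1 - rho^-1) + 2 * d) * x t <= rho * x t by rewrite ler_wpM2r// gap.
  have h1 : x t / rho <= x s1 by rewrite ler_pdivrMr// mulrC.
  have : b * Num.max 0 (x t - x s1) <= b * (1 - rho^-1) * x t.
    rewrite -mulrA ler_pM2l// ge_max; apply/andP; split.
      by rewrite mulr_ge0// subr_ge0 invf_le1.
    by rewrite mulrBl mul1r; lra.
  lra.
Qed.

(** The same when the exponent is only known to be at most [b]: two earlier points are
    needed, and the lower one limits the next value.  For extrapolation they must be
    separated; a separation of 1 costs a factor [x t] in the prediction error, which
    [eta * x t] absorbs. *)
Record unknown_exponent_orbit (R : realType) (b eta C X0 : R) (x : nat -> R) (n : nat) : Prop := UnknownExponentOrbit {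
  unknown_ge0 : forall t, 0 <= x t;
  unknown_init : x 0%N <= X0;
  unknown_crude : forall t, (t < n)%N -> x t.+1 <= b * x t + C;
  unknown_inter : forall t lo hi, (t < n)%N -> (lo < t)%N -> (hi < t)%N ->
    x lo <= x t -> x t <= x hi -> x lo < x hi ->
    x t.+1 <= b * (x t - x lo) + eta * x t + C;
  unknown_extra : forall t lo hi, (t < n)%N -> (lo < t)%N -> (hi < t)%N ->
    x lo + 1 <= x hi -> x hi <= x t ->
    x t.+1 <= b * (x t - x lo) + eta * x t + C }.

Lemma unknown_exponent_orbit_bounded (R : realType) (b : R) : 0 < b -> 4 * b ^+ 2 < 27 ->
  exists2 eta : R, 0 < eta & forall C X0 : R, 0 <= C -> 0 <= X0 ->
  exists Bd, forall x n, unknown_exponent_orbit b eta C X0 x n -> forall s, (s <= n)%N -> x s <= Bd.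
Proof.
move=> b0 b4; have [d d0 gap] := unknown_exponent_margin b0 b4.
exists d => // C X0 C0 X00.
apply: (@bounded_by_descent _ _ (b + 1) d) => //.
- by move=> x n [].
- exists (b * C + C + X0) => [|x n [x0 xi crude _ _] s sn].
    by rewrite !addr_ge0// mulr_ge0// ltW.
  case: s sn => [_|t tn Xt].
    have bC : 0 <= b * C by rewrite mulr_ge0// ltW.
    by move=> Xx; exfalso; lra.
  exists t; split=> //; have := crude t tn.
  have [Ct|tC] := leP C (x t); first by lra.
  have : b * x t <= b * C by rewrite ler_pM2l// ltW.
  lra.
- move=> rho X rho1 X_0; pose m := rho * (X + 1) + (b + C) / d.
  have Cd : 0 <= (b + C) / d by rewrite divr_ge0 ?(ltW d0)//; lra.
  have rX : X + 1 <= rho * (X + 1) by rewrite ler_peMl//; lra.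
  have bm : 0 <= b * m by rewrite mulr_ge0 ?(ltW b0)//; rewrite /m; lra.
  exists (b * m + C + X0) => [|x n [x0 xi crude inter extra] dx s sn]; first by rewrite !addr_ge0.
  case: s sn => [_ Xx|t tn Xt]; first by exfalso; lra.
  have xm : m < x t.
    rewrite ltNge; apply/negP => h.
    have : b * x t <= b * m by rewrite ler_pM2l.
    by have := crude t tn; lra.
  exists t; split=> //.
  have Xx : X + 1 < x t by rewrite /m in xm; lra.
  have Xxt : X < x t by lra.
  have [s1 [s1t xs1]] := dx t (ltnW tn) Xxt.
  have r0 : 0 < rho by lra.
  have i0 : 0 < rho^-1 by rewrite invr_gt0.
  have i1 : rho^-1 <= 1 by rewrite invf_le1.
  have hd : b + C <= d * x t by rewrite mulrC -ler_pdivrMr//; rewrite /m in xm; lra.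
  have hg : (b * (1 - rho^-2) + 3 * d) * x t <= rho * x t by rewrite ler_wpM2r// gap.
  suff lowpt lo : x t / rho ^+ 2 - 1 <= x lo ->
      x t.+1 <= b * (x t - x lo) + d * x t + C -> x t.+1 <= (rho - d) * x t.
    have h1 : x t / rho <= x s1 by rewrite ler_pdivrMr// mulrC.
    have h2 : x t / rho ^+ 2 <= x t / rho.
      by rewrite expr2 invfM mulrA ler_piMr// mulr_ge0// ltW.
    have h3 : x t / rho <= x t by rewrite ler_piMr.
    have Xr : X + 1 < x t / rho.
      by rewrite ltr_pdivlMr// mulrC; rewrite /m in xm; lra.
    (* Interpolation: the first point hi at or above x t has an earlier point lo
       with rho * x lo >= x hi, and lo lies below x t by the choice of hi. *)
    have [[hi0 [hi0t thi0]]|new] := pselect (exists hi, (hi < t)%N /\ x t <= x hi).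
      have [hi [hihi0 thi below]] := first_time_ge thi0.
      have hit : (hi < t)%N := leq_ltn_trans hihi0 hi0t.
      have Xhi : X < x hi by lra.
      have [lo [lohi xlo]] := dx hi (ltnW (ltn_trans hit tn)) Xhi.
      have lot := below lo lohi.
      have xlo' : x t / rho <= x lo by rewrite ler_pdivrMr// mulrC; lra.
      apply: (lowpt lo); first by lra.
      apply: (inter t lo hi tn (ltn_trans lohi hit) hit (ltW lot) thi).
      exact: lt_le_trans lot thi.
    (* Extrapolation: hi is the first point above x t / rho, and lo descends from mid,
       the first point above x t / rho - 1, so that lo and hi are 1 apart. *)
    have [hi [his1 xhi _]] := first_time_ge h1.
    have hi1 : x t / rho - 1 <= x hi by lra.
    have [mid [midhi xmid below]] := first_time_ge hi1.
    have hit : (hi < t)%N := leq_ltn_trans his1 s1t.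
    have midt : (mid < t)%N := leq_ltn_trans midhi hit.
    have Xmid : X < x mid by lra.
    have [lo [lomid xlo]] := dx mid (ltnW (ltn_trans midt tn)) Xmid.
    have lolt := below lo lomid.
    apply: (lowpt lo).
      have : x mid / rho <= x lo by rewrite ler_pdivrMr// mulrC.
      have : (x t / rho - 1) / rho <= x mid / rho by rewrite ler_pM2r.
      by rewrite mulrBl mul1r expr2 invfM mulrA; lra.
    apply: (extra t lo hi tn (ltn_trans lomid midt) hit); first by lra.
    by rewrite leNgt; apply/negP => h; apply: new; exists hi; split; rewrite ?ltW.
  move=> hlo; suff : b * (x t - x lo) <= b * (1 - rho^-2) * x t + b by lra.
  have : b * (x t - x lo) <= b * (x t - x t / rho ^+ 2 + 1).
    by rewrite ler_pM2l//; lra.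
  lra.
Qed.

(** * Differences of two exponentials *)

(** Convexity of the exponential, in the form used for all Lipschitz estimates. *)
Lemma expR_sub_le (R : realType) (u v : R) : expR v - expR u <= (v - u) * expR v.
Proof.
have := expR_ge1Dx (u - v); rewrite -(ler_pM2r (expR_gt0 v)) -expRD subrK; lra.
Qed.

Lemma expR_sub_ge (R : realType) (u v : R) : (v - u) * expR u <= expR v - expR u.
Proof. by have := expR_sub_le v u; lra. Qed.

(** The prediction error of the model [(a', b')] for the model [(a, b)] at a point with
    logarithmic size [x]. *)
Definition expdiff (R : realType) (a b a' b' x : R) := a * expR (b * x) - a' * expR (b' * x).

(** For [b <> b'] the functions [e ^ (b x)] and [e ^ (b' x)] form a Chebyshev system, so
    [expdiff] is determined by its values at [lo] and [hi]; after division by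
    [e ^ (b' x)] this is linear interpolation in the variable [e ^ ((b - b') x)]. *)
Lemma expdiff_lagrange (R : realType) (a b a' b' lo hi x : R) :
  (expR ((b - b') * hi) - expR ((b - b') * lo)) * expdiff a b a' b' x =
  expR (b' * (x - lo)) * (expR ((b - b') * hi) - expR ((b - b') * x)) * expdiff a b a' b' lo +
  expR (b' * (x - hi)) * (expR ((b - b') * x) - expR ((b - b') * lo)) * expdiff a b a' b' hi.
Proof.
rewrite /expdiff.
have E z : expR (b * z) = expR ((b - b') * z) * expR (b' * z).
  by rewrite -expRD; congr expR; ring.
have F u v : expR (b' * (u - v)) = expR (b' * u) / expR (b' * v).
  by rewrite -expRN -expRD; congr expR; ring.
rewrite !E !F; field.
by rewrite !gt_eqF ?expR_gt0.
Qed.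

Lemma expdiffC (R : realType) (a b a' b' x : R) :
  expdiff a b a' b' x = - expdiff a' b' a b x.
Proof. by rewrite /expdiff; ring. Qed.

Lemma expdiff_same (R : realType) (a a' b x z : R) :
  expdiff a b a' b x = expR (b * (x - z)) * expdiff a b a' b z.
Proof.
have F : expR (b * x) = expR (b * (x - z)) * expR (b * z).
  by rewrite -expRD; congr expR; ring.
by rewrite /expdiff F; ring.
Qed.

Section ExpdiffBounds.
Context (R : realType) (K bm a b a' b' lo hi x : R).
Hypotheses (b_ge0 : 0 <= b) (b'_ge0 : 0 <= b') (b_le : b <= bm) (b'_le : b' <= bm).
Hypotheses (Klo : `|expdiff a b a' b' lo| <= K) (Khi : `|expdiff a b a' b' hi| <= K).

Let E := expR (bm * (x - lo)).
Let expE c : 0 <= c -> c <= bm -> lo <= x -> expR (c * (x - lo)) <= E.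
Proof. by move=> c0 cb lx; rewrite ler_expR ler_wpM2r// subr_ge0. Qed.

Let via_lagrange k : b' < b -> lo < hi ->
  expR (b' * (x - lo)) * `|expR ((b - b') * hi) - expR ((b - b') * x)| <=
    k * (expR ((b - b') * hi) - expR ((b - b') * lo)) ->
  expR (b' * (x - hi)) * `|expR ((b - b') * x) - expR ((b - b') * lo)| <=
    k * (expR ((b - b') * hi) - expR ((b - b') * lo)) ->
  `|expdiff a b a' b' x| <= 2 * K * k.
Proof.
move=> bb lohi h1 h2.
have K0 : 0 <= K by apply: le_trans Klo.
have g : 0 < expR ((b - b') * hi) - expR ((b - b') * lo).
  by rewrite subr_gt0 ltr_expR ltr_pM2l// subr_gt0.
rewrite -(ler_pM2l g) -{1}(ger0_norm (ltW g)) -normrM (expdiff_lagrange _ _ _ _ lo hi).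
apply: le_trans (ler_normD _ _) _; rewrite !normrM !(ger0_norm (expR_ge0 _)).
move: h1 h2 => /(ler_wpM2r K0) h1 /(ler_wpM2r K0) h2.
apply: le_trans (lerD (le_trans (ler_wpM2l _ Klo) h1) (le_trans (ler_wpM2l _ Khi) h2)) _.
- by rewrite mulr_ge0// expR_ge0.
- by rewrite mulr_ge0// expR_ge0.
- lra.
Qed.

Let K_ge0 : 0 <= K. Proof. exact: le_trans Klo. Qed.

Lemma expdiff_same_le : b = b' -> lo <= x -> `|expdiff a b a' b' x| <= K * E.
Proof.
move=> bb lx; move: Klo; rewrite -bb => Kl.
rewrite (expdiff_same _ _ _ x lo) normrM (ger0_norm (expR_ge0 _)) mulrC.
by rewrite ler_pM// ?expR_ge0// expE.
Qed.

(** Both weights of the interpolation are at most 1 up to the factor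
    [e ^ (b' (x - lo))]. *)
Lemma expdiff_inter_lt : b' < b -> lo <= x -> x <= hi -> lo < hi ->
  `|expdiff a b a' b' x| <= 2 * K * E.
Proof.
move=> bb lx xh lohi; have c0 : 0 < b - b' by rewrite subr_gt0.
have zl : expR ((b - b') * lo) <= expR ((b - b') * x) by rewrite ler_expR ler_pM2l.
have hz : expR ((b - b') * x) <= expR ((b - b') * hi) by rewrite ler_expR ler_pM2l.
apply: via_lagrange => //.
  rewrite ger0_norm ?subr_ge0//; apply: ler_pM (expR_ge0 _) _ (expE _ _ _) _ => //.
    by rewrite subr_ge0.
  by rewrite lerD2l lerN2.
rewrite ger0_norm ?subr_ge0//; apply: ler_pM (expR_ge0 _) _ _ _; rewrite ?subr_ge0 ?lerD2r//.
apply: (@le_trans _ _ (expR (b' * (x - lo)))); last exact: expE.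
by rewrite ler_expR ler_wpM2l//; lra.
Qed.

(** The quotients of increments of [e ^ ((b - b') x)] are compared with quotients of
    lengths by convexity, which moves the exponent from [b'] to [b] and leaves the
    factor [x / (hi - lo) <= x]. *)
Lemma expdiff_extra_lt : b' < b -> 0 <= lo -> lo + 1 <= hi -> hi <= x ->
  `|expdiff a b a' b' x| <= 2 * K * (x * E).
Proof.
move=> bb l0 lohi hx; have c0 : 0 < b - b' by rewrite subr_gt0.
pose c := b - b'; rewrite -/c in c0.
have zl : expR (c * lo) <= expR (c * x) by rewrite ler_expR ler_pM2l//; lra.
have hz : expR (c * hi) <= expR (c * x) by rewrite ler_expR ler_pM2l//; lra.
have main v : lo <= v -> v <= x ->
    expR (b' * (x - lo)) * (expR (c * x) - expR (c * v)) <=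
    x * E * (expR (c * hi) - expR (c * lo)).
  move=> lv vx.
  have h1 : expR (c * x) - expR (c * v) <= c * x * expR (c * x).
    apply: le_trans (expR_sub_le _ _) _.
    rewrite ler_pM2r ?expR_gt0// -mulrBr ler_pM2l//; lra.
  have h2 : c * expR (c * lo) <= expR (c * hi) - expR (c * lo).
    apply: le_trans (expR_sub_ge _ _).
    by rewrite ler_pM2r ?expR_gt0// -mulrBr -{1}[c]mulr1 ler_pM2l//; lra.
  have h3 : expR (b' * (x - lo)) * expR (c * x) = expR (b * (x - lo)) * expR (c * lo).
    by rewrite -!expRD /c; congr expR; ring.
  apply: (@le_trans _ _ (x * (expR (b * (x - lo)) * (c * expR (c * lo))))).
    rewrite (_ : x * _ = expR (b' * (x - lo)) * (c * x * expR (c * x))).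
      by rewrite ler_pM2l// expR_gt0.
    by rewrite (mulrCA _ c) -h3; ring.
  rewrite -mulrA ler_wpM2l//; first by lra.
  by rewrite ler_pM ?expR_ge0 ?expE ?mulr_ge0 ?expR_ge0 ?(ltW c0)//; lra.
apply: via_lagrange => //; first by lra.
  by rewrite distrC ger0_norm ?subr_ge0//; apply: main; lra.
rewrite ger0_norm ?subr_ge0//.
apply: le_trans (main lo _ _); rewrite ?lexx//; last by lra.
rewrite ler_wpM2r ?subr_ge0// ler_expR ler_wpM2l//; lra.
Qed.

End ExpdiffBounds.

Lemma expdiff_inter (R : realType) (K bm a b a' b' lo hi x : R) :
  0 <= b -> 0 <= b' -> b <= bm -> b' <= bm ->
  `|expdiff a b a' b' lo| <= K -> `|expdiff a b a' b' hi| <= K ->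
  lo <= x -> x <= hi -> lo < hi ->
  `|expdiff a b a' b' x| <= 2 * K * expR (bm * (x - lo)).
Proof.
move=> b0 b'0 bbm b'bm Kl Kh lx xh lh; have [bb|bb|bb] := ltgtP b b'.
- by rewrite expdiffC normrN; apply: expdiff_inter_lt lx xh lh => //; rewrite expdiffC normrN.
- exact: expdiff_inter_lt lx xh lh.
- have K0 : 0 <= K by apply: le_trans Kl.
  apply: le_trans (expdiff_same_le b0 bbm Kl bb lx) _.
  by rewrite ler_pM2r ?expR_gt0//; lra.
Qed.

Lemma expdiff_extra (R : realType) (K bm a b a' b' lo hi x : R) :
  0 <= b -> 0 <= b' -> b <= bm -> b' <= bm ->
  `|expdiff a b a' b' lo| <= K -> `|expdiff a b a' b' hi| <= K ->
  0 <= lo -> lo + 1 <= hi -> hi <= x ->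
  `|expdiff a b a' b' x| <= 2 * K * (x * expR (bm * (x - lo))).
Proof.
move=> b0 b'0 bbm b'bm Kl Kh l0 lh hx; have [bb|bb|bb] := ltgtP b b'.
- by rewrite expdiffC normrN; apply: expdiff_extra_lt lh hx => //; rewrite expdiffC normrN.
- exact: expdiff_extra_lt lh hx.
- have K0 : 0 <= K by apply: le_trans Kl.
  have lx : lo <= x by lra.
  apply: le_trans (expdiff_same_le b0 bbm Kl bb lx) _.
  rewrite mulrA ler_pM2r ?expR_gt0// -mulrA mulrCA ler_peMr//; lra.
Qed.

(** Truncation at 1 makes the logarithmic scale nonnegative; below size 1 every power is
    bounded anyway. *)
Definition logsize (R : realType) (y : R) : R := ln (Num.max 1 `|y|).

Lemma expR_logsize (R : realType) (y : R) : expR (logsize y) = Num.max 1 `|y|.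
Proof. by rewrite lnK// posrE lt_max ltr01. Qed.

Lemma logsize_ge0 (R : realType) (y : R) : 0 <= logsize y.
Proof. by rewrite ln_ge0// le_max lexx. Qed.

Lemma norm_le_logsize (R : realType) (y : R) : `|y| <= expR (logsize y).
Proof. by rewrite expR_logsize le_max lexx orbT. Qed.

Lemma logsize_le (R : realType) (y z : R) : 1 + `|y| <= expR z -> logsize y <= z.
Proof.
move=> h; rewrite -ler_expR expR_logsize; apply: le_trans h.
by rewrite ge_max lerDl normr_ge0 lerDr ler01.
Qed.

Lemma phi_large (R : realType) (b y : R) : 1 <= `|y| -> phi b y = Num.sg y * expR (b * logsize y).
Proof.
move=> y1; rewrite /phi mulrC (mulrC b) expRM expR_logsize mulrC; congr (_ * (_ `^ _)).
by apply/esym/max_idPr.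
Qed.

Lemma phi_small (R : realType) (b y : R) : 0 <= b -> `|y| <= 1 -> `|phi b y| <= 1.
Proof.
move=> b0 y1; rewrite /phi normrM (ger0_norm (powR_ge0 _ _)) -(mulr1 1).
rewrite ler_pM ?normr_ge0 ?powR_ge0//.
  by rewrite normr_sg; case: (y == 0) => //=.
rewrite [leRHS](_ : _ = 1 `^ b); last by rewrite powR1.
by apply: ge0_ler_powR; rewrite ?nnegrE.
Qed.

Lemma phi_le (R : realType) (b y : R) : 0 <= b -> `|phi b y| <= expR (b * logsize y).
Proof.
move=> b0; have [y1|/ltW y1] := leP 1 `|y|.
  rewrite phi_large// normrM (ger0_norm (expR_ge0 _)) ler_piMl ?expR_ge0//.
  by rewrite normr_sg; case: (y == 0) => //=.
apply: le_trans (phi_small b0 y1) _.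
by rewrite -expR0 ler_expR mulr_ge0// logsize_ge0.
Qed.

Lemma phi_diff_expdiff (R : realType) (a b a' b' y : R) : 1 <= `|y| ->
  `|a * phi b y - a' * phi b' y| = `|expdiff a b a' b' (logsize y)|.
Proof.
move=> y1; rewrite !phi_large// /expdiff !(mulrCA _ (Num.sg y)) -mulrBr normrM normr_sg.
by rewrite -normr_gt0 (lt_le_trans ltr01 y1) mul1r.
Qed.

Lemma phi_diff_small (R : realType) (M a b a' b' y : R) :
  0 <= b -> 0 <= b' -> `|a| <= M -> `|a'| <= M -> `|y| <= 1 ->
  `|a * phi b y - a' * phi b' y| <= 2 * M.
Proof.
move=> b0 b'0 aM a'M y1; apply: le_trans (ler_normB _ _) _; rewrite (normrM a) (normrM a').
have := ler_pM (normr_ge0 _) (normr_ge0 _) aM (phi_small b0 y1).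
have := ler_pM (normr_ge0 _) (normr_ge0 _) a'M (phi_small b'0 y1); lra.
Qed.

Lemma expdiff_of_phi (R : realType) (M K a b a' b' y : R) :
  `|a| <= M -> `|a'| <= M -> 2 * M <= K ->
  `|a * phi b y - a' * phi b' y| <= K -> `|expdiff a b a' b' (logsize y)| <= K.
Proof.
move=> aM a'M MK h; have [y1|y1] := leP 1 `|y|; first by rewrite -phi_diff_expdiff.
rewrite /logsize (max_idPl (ltW y1)) ln1 /expdiff !mulr0 expR0 !mulr1.
by apply: le_trans (ler_normB _ _) _; lra.
Qed.

Lemma phi_of_expdiff (R : realType) (M k a b a' b' y : R) :
  0 <= b -> 0 <= b' -> `|a| <= M -> `|a'| <= M ->
  `|expdiff a b a' b' (logsize y)| <= k -> `|a * phi b y - a' * phi b' y| <= 2 * M + k.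
Proof.
move=> b0 b'0 aM a'M h; have k0 : 0 <= k by apply: le_trans h.
have M0 : 0 <= M by apply: le_trans aM.
have [y1|y1] := leP 1 `|y|; first by rewrite phi_diff_expdiff//; lra.
have := phi_diff_small b0 b'0 aM a'M (ltW y1); lra.
Qed.

(** * Feedback laws for classes of models *)

(** A law is given the whole trajectory, and [causal] expresses that it uses the past
    only.  Compared with maps on vectors of growing length this makes the restart of a
    law at a later time a mere shift of the trajectory. *)
Definition law (R : Type) := (nat -> R) -> nat -> R.

Definition causal (R : Type) (L : law R) := forall (y y' : nat -> R) t,
  (forall i, (i <= t)%N -> y i = y' i) -> L y t = L y' t.

(** Stated by residuals and up to a finite horizon [n], so that the same finite data can
    be a trajectory of several models. *)
Definition trajectory (R : realType) (W : R) (F : R -> R) (L : law R) (y : nat -> R) (n : nat) :=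
  forall t, (t < n)%N -> `|y t.+1 - F (y t) - L y t| <= W.

Definition bounds (R : realType) (W : R) (Fs : set (R -> R)) (L : law R) (Y Bd : R) :=
  forall F y n, Fs F -> `|y 0%N| <= Y -> trajectory W F L y n -> `|y n| <= Bd.

Definition stabilizable_from (R : realType) (W : R) (Fs : set (R -> R)) (Y : R) :=
  exists L, causal L /\ exists Bd, bounds W Fs L Y Bd.

Lemma trajectoryW (R : realType) (W : R) F L (y : nat -> R) m n :
  (m <= n)%N -> trajectory W F L y n -> trajectory W F L y m.
Proof. by move=> mn tr t tm; apply: tr; apply: leq_trans tm mn. Qed.

Lemma course_of_values (T : Type) (x0 : T) (step : (nat -> T) -> nat -> T) :
  (forall u u' t, (forall i, (i < t)%N -> u i = u' i) -> step u t = step u' t) ->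
  exists u, forall t, u t = step u t.
Proof.
move=> cstep.
pose U := fix U (n : nat) : nat -> T :=
  if n is m.+1 then fun i => if i == m then step (U m) m else U m i else fun=> x0.
have UE n i : (i < n)%N -> U n i = U i.+1 i.
  elim: n => // n IHn; rewrite ltnS leq_eqVlt => /predU1P[->//|ltin].
  by rewrite /= (ltn_eqF ltin) IHn.
exists (fun t => U t.+1 t) => t; rewrite [LHS]/= eqxx; apply: cstep => i it.
exact: UE.
Qed.

(** Whether a model fits the data depends on the earlier inputs, so a law must be able
    to consult its own earlier decisions. *)
Lemma recursive_law (R : realType) (step : (nat -> R) -> (nat -> R) -> nat -> R) :
  (forall y y' u u' t, (forall i, (i <= t)%N -> y i = y' i) ->
     (forall i, (i < t)%N -> u i = u' i) -> step y u t = step y' u' t) ->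
  exists L : law R, causal L /\ forall y t, L y t = step y (L y) t.
Proof.
move=> cstep.
have LX y : exists u, forall t, u t = step y u t.
  by apply: (course_of_values 0) => u u' t uu'; exact: cstep.
have [L LE] := boolp.choice LX; exists L; split=> // y y'.
elim/ltn_ind => t IHt yy'; rewrite LE (LE y'); apply: cstep => // i it.
by apply: IHt => // j ji; apply: yy'; rewrite (leq_trans ji)// ltnW.
Qed.

(** The input cancels the prediction of some model that fits all data up to now.  Two
    models that fit the data differ by at most [2 * W] at every past state. *)
Lemma certainty_equivalence (R : realType) (W : R) (Fs : set (R -> R)) (Y : R) :
  (exists Bd, forall F y n, Fs F -> `|y 0%N| <= Y ->
     (forall t, (t < n)%N -> exists F', [/\ Fs F',
        forall s, (s < t)%N -> `|F (y s) - F' (y s)| <= 2 * W &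
        `|y t.+1| <= `|F (y t) - F' (y t)| + W]) -> `|y n| <= Bd) ->
  stabilizable_from W Fs Y.
Proof.
move=> [Bd HB].
pose fits (y u : nat -> R) t : set (R -> R) :=
  [set F' | Fs F' /\ forall s, (s < t)%N -> `|y s.+1 - F' (y s) - u s| <= W].
have pickX (S : set (R -> R)) : exists F, S !=set0 -> S F.
  have [[F SF]|nS] := pselect (S !=set0); first by exists F.
  by exists (fun=> 0) => /nS.
have [pick pickP] := boolp.choice pickX.
have [|L [cL LE]] := @recursive_law R (fun y u t => - pick (fits y u t) (y t)).
  move=> y y' u u' t yy' uu'; rewrite (yy' t)//; congr (- pick _ _).
  rewrite /fits; apply/seteqP; split=> F' /= [FF' h]; split=> // s st.
    by rewrite -uu'// -!yy'// ?h// ltnW.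
  by rewrite uu'// !yy'// ?h// ltnW.
exists L; split=> //; exists Bd => F y n FF y0 tr; apply: (HB F) => // t tn.
have [FF' fit] : fits y (L y) t (pick (fits y (L y) t)).
  apply: pickP; exists F; split=> // s st; apply: tr; exact: ltn_trans tn.
exists (pick (fits y (L y) t)); split=> //.
- move=> s st; have h1 := tr s (ltn_trans st tn); have h2 := fit s st.
  rewrite (_ : F _ - _ = (y s.+1 - pick (fits y (L y) t) (y s) - L y s)
                        - (y s.+1 - F (y s) - L y s)); last by ring.
  by apply: le_trans (ler_normB _ _) _; lra.
- have := tr t tn; rewrite {1}LE => h.
  rewrite (_ : y t.+1 = (F (y t) - pick (fits y (L y) t) (y t)) +
     (y t.+1 - F (y t) - - pick (fits y (L y) t) (y t))); last by ring.
  by apply: le_trans (ler_normD _ _) _; rewrite lerD2l.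
Qed.

(** The first law runs with the possibly larger noise level [W1] until the data refute
    every model of [Fs1]; then the second law restarts from the present state.  Before
    the refutation the data are a trajectory of [Fs1], which bounds the state and, since
    the next state of that trajectory would be bounded too, also the input.  A true model
    close to [Fs1] on the region [`|y| <= B1] is never refuted, because the state does not
    leave that region. *)
Lemma switching (R : realType) (W W1 : R) (Fs1 Fs2 Fs : set (R -> R)) (L1 : law R)
    (Y B1 G : R) :
  W <= W1 -> 0 <= W1 -> Fs1 !=set0 -> causal L1 -> bounds W1 Fs1 L1 Y B1 ->
  (forall F y, Fs1 F \/ Fs F -> `|y| <= B1 -> `|F y| <= G) ->
  (forall F, Fs F -> Fs2 F \/
     exists2 F1, Fs1 F1 & forall y, `|y| <= B1 -> `|F y - F1 y| <= W1 - W) ->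
  stabilizable_from W Fs2 (B1 + 2 * G + W) ->
  stabilizable_from W Fs Y.
Proof.
move=> WW1 W10 [F0 F0s] cL1 bL1 crude cover [L2 [cL2 [B2 bL2]]].
pose ok (y : nat -> R) m := exists2 F1, Fs1 F1 & trajectory W1 F1 L1 y m.
pose fail (y : nat -> R) : set nat := [set m | ~ ok y m /\ forall i, (i < m)%N -> ok y i].
pose L y t := if `[< ok y t >] then L1 y t else
  L2 (fun i => y (xget 0%N (fail y) + i)%N) (t - xget 0%N (fail y))%N.
have okW y m n : (m <= n)%N -> ok y n -> ok y m.
  by move=> mn [F1 F1s tr]; exists F1 => //; apply: trajectoryW tr.
have okE y y' t : (forall i, (i <= t)%N -> y i = y' i) -> ok y t -> ok y' t.
  move=> yy' [F1 F1s tr]; exists F1 => // s st.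
  rewrite -!yy'//; last exact: ltnW.
  rewrite -(cL1 y y') ?tr// => i is_.
  by apply: yy'; rewrite (leq_trans is_)// ltnW.
have failU y m m' : fail y m -> fail y m' -> m = m'.
  move=> [nok h] [nok' h']; case: (ltngtP m m') => //; first by move/h'.
  by move/h.
have failX y t : ~ ok y t -> exists2 m, (m <= t)%N & fail y m.
  move=> nok; have ex : exists m, ~~ `[< ok y m >] by exists t; apply/asboolPn.
  case: (ex_minnP ex) => m /asboolPn nokm min; exists m.
    by apply: min; apply/asboolPn.
  split=> // i im; apply: contrapT => nok'.
  have mi : (m <= i)%N by apply: min; apply/asboolPn.
  by move: im; rewrite ltnNge mi.
have xgetE y m : fail y m -> xget 0%N (fail y) = m.
  by move=> fm; apply: (failU _ _ _ _ fm); apply: xgetPex; exists m.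
exists L; split.
  move=> y y' t yy'; rewrite /L.
  have okt : `[< ok y t >] = `[< ok y' t >].
    by apply/asbool_equiv_eq; split; apply: okE => // i it; rewrite yy'.
  rewrite okt; case: asboolP => [_|nok]; first exact: cL1.
  have [m mt fm] : exists2 m, (m <= t)%N & fail y m.
    by apply: failX => okyt; apply: nok; apply: okE okyt.
  have yyi i : (i <= m)%N -> forall j, (j <= i)%N -> y j = y' j.
    by move=> im j ji; apply: yy'; rewrite (leq_trans ji)// (leq_trans im).
  have fm' : fail y' m.
    case: fm => nokm h; split=> [okm|i im].
      by apply: nokm; apply: okE okm => i im; rewrite (yyi m).
    by apply: (okE y) (h i im); apply: yyi; exact: ltnW.
  rewrite (xgetE _ _ fm) (xgetE _ _ fm'); apply: cL2 => i it.
  by apply: yy'; rewrite -leq_subRL.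
exists (Num.max B1 B2) => F y n FF y0 tr; rewrite le_max.
have [[F1 F1s tr1]|nok] := pselect (ok y n).
  by rewrite (bL1 F1 y n F1s y0 tr1).
have [m mn fm] := failX y n nok.
have [k mk] : exists k, m = k.+1.
  case: m mn fm => [|k]; last by exists k.
  by move=> _ [[]]; exists F0.
have okk t : (t <= k)%N -> ok y t by move=> tk; apply: fm.2; rewrite mk ltnS.
have yB1 t : (t <= k)%N -> `|y t| <= B1.
  by move=> /okk [F1 F1s tr1]; exact: bL1 tr1.
have LL1 t : (t <= k)%N -> L y t = L1 y t.
  by move=> /okk okt; rewrite /L; case: asboolP.
have F2 : Fs2 F.
  have [//|[F1 F1s close]] := cover F FF.
  exfalso; apply: fm.1; exists F1 => // t; rewrite mk ltnS => tk.
  have := tr t (leq_ltn_trans tk _); rewrite LL1// -mk => /(_ mn) h.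
  rewrite (_ : _ - _ - _ = (y t.+1 - F (y t) - L1 y t) + (F (y t) - F1 (y t))); last by ring.
  apply: le_trans (ler_normD _ _) _.
  by have := close (y t) (yB1 t tk); lra.
have ym : `|y m| <= B1 + 2 * G + W.
  have [F1 F1s tr1] := okk k (leqnn k).
  (* The input at time k is bounded by continuing the data, without noise, as a
     trajectory z of the model F1 that fits them up to time k. *)
  pose z i := if (i <= k)%N then y i else F1 (y k) + L1 y k.
  have zy i : (i <= k)%N -> z i = y i by rewrite /z => ->.
  have Lz t : (t <= k)%N -> L1 z t = L1 y t.
    by move=> tk; apply: cL1 => i it; rewrite zy// (leq_trans it).
  have : `|z k.+1| <= B1.
    apply: (bL1 F1 z k.+1 F1s); first by rewrite zy.
    move=> t; rewrite ltnS => tk; rewrite Lz// (zy t)//.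
    move: tk; rewrite leq_eqVlt => /predU1P[->|tk].
      by rewrite /z ltnn -addrA -opprD subrr normr0.
    by rewrite zy//; exact: tr1.
  rewrite /z ltnn => h1.
  have := tr k; rewrite -mk LL1// => /(_ mn) h2.
  have h3 := crude F1 (y k) (or_introl F1s) (yB1 k (leqnn k)).
  have h4 := crude F (y k) (or_intror FF) (yB1 k (leqnn k)).
  rewrite (_ : y m = (y m - F (y k) - L1 y k) + F (y k) + (F1 (y k) + L1 y k) - F1 (y k));
    last by ring.
  apply: le_trans (ler_normB _ _) _.
  have := ler_normD (y m - F (y k) - L1 y k + F (y k)) (F1 (y k) + L1 y k).
  have := ler_normD (y m - F (y k) - L1 y k) (F (y k)).
  lra.
have := bL2 F (fun i => y (m + i)%N) (n - m)%N F2; rewrite addn0 subnKC// => ->.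
- by rewrite orbT.
- exact: ym.
move=> i inm; have mi : (m + i < n)%N by rewrite -ltn_subRL.
have nokmi : ~ ok y (m + i)%N by move=> /(okW y m) okm; apply: fm.1; apply: okm; exact: leq_addr.
have := tr (m + i)%N mi; rewrite {1}/L; case: asboolP => // _.
by rewrite (xgetE _ _ fm) addKn addnS.
Qed.

(** The law may read off an integer bound for [y 0] and use the law designed for it. *)
Lemma law_for_all_starts (R : realType) (W : R) (Fs : set (R -> R)) :
  (forall Y, stabilizable_from W Fs Y) ->
  exists L, causal L /\ forall Y, exists Bd, bounds W Fs L Y Bd.
Proof.
move=> st.
have LX (k : nat) : exists L : law R * R, causal L.1 /\ bounds W Fs L.1 k%:R L.2.
  by have [L [cL [Bd bL]]] := st k%:R; exists (L, Bd).
have [Ls LsP] := boolp.choice LX.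
pose N (z : R) := (Num.trunc `|z|).+1.
exists (fun y => (Ls (N (y 0%N))).1 y); split=> [y y' t yy'|Y].
  by rewrite (yy' 0%N)//; apply: (LsP _).1.
exists (\sum_(k < (N Y).+1) `|(Ls k).2|) => F y n FF y0 tr.
have NY : (N (y 0%N) < (N Y).+1)%N.
  rewrite !ltnS; apply: le_truncn; exact: le_trans y0 (ler_norm _).
have y0N : `|y 0%N| <= (N (y 0%N))%:R by apply: ltW; apply: truncnS_gt.
apply: le_trans ((LsP (N (y 0%N))).2 F y n FF y0N tr) _.
rewrite (bigD1 (Ordinal NY))//=; apply: le_trans (ler_norm _) _.
by rewrite lerDl sumr_ge0.
Qed.

(** * Stabilization of power nonlinearities *)

Definition power_class (R : realType) (M : R) (Bs : set R) : set (R -> R) :=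
  [set F | exists a b : R, [/\ `|a| <= M, Bs b & F = fun y => a * phi b y]].

(** Multiplicative constants become additive ones on the logarithmic scale. *)
Lemma logsize_absorb (R : realType) (y k0 k1 C m : R) :
  0 <= k0 -> 0 <= k1 -> 0 <= m -> k0 + k1 <= C -> `|y| <= k0 + k1 * expR m ->
  logsize y <= m + C.
Proof.
move=> k00 k10 m0 kC yk; apply: logsize_le; rewrite expRD.
have e1 : 1 <= expR m by rewrite -expR0 ler_expR.
have : expR m * (1 + C) <= expR m * expR C by rewrite ler_pM2l ?expR_gt0// expR_ge1Dx.
have : k0 <= k0 * expR m by rewrite ler_peMr.
have : (k0 + k1) * expR m <= C * expR m by rewrite ler_pM2r ?expR_gt0.
lra.
Qed.

Lemma logsize_le_norm (R : realType) (y Y : R) : `|y| <= Y -> logsize y <= Y.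
Proof.
by move=> yY; apply: logsize_le; apply: le_trans (expR_ge1Dx Y); rewrite lerD2l.
Qed.

Lemma power_class_crude (R : realType) (M bm V : R) (Bs : set R) F y :
  (forall b, Bs b -> 0 <= b <= bm) -> power_class M Bs F -> `|y| <= V ->
  `|F y| <= M * expR (bm * V).
Proof.
move=> Bsb [a [b [aM /Bsb/andP[b0 bbm] ->]]] yV.
rewrite normrM; apply: ler_pM => //; apply: le_trans (phi_le _ b0) _.
by rewrite ler_expR ler_pM ?logsize_ge0 ?logsize_le_norm.
Qed.

Lemma known_exponent_stabilizable (R : realType) (W M b Y : R) :
  0 <= W -> 0 <= M -> 0 < b -> b < 4 ->
  stabilizable_from W (power_class M [set b]) Y.
Proof.
move=> W0 M0 b0 b4; apply: certainty_equivalence.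
pose K := 2 * W + 2 * M; pose C := W + 2 * M + K.
have K0 : 0 <= K by rewrite /K; lra.
have [|Bd HB] := @known_exponent_orbit_bounded R b C `|Y| b0 b4 _ (normr_ge0 _).
  by rewrite /C /K; lra.
exists (expR Bd) => F y n [a [_ [aM -> FE]]] y0 dyn.
apply: le_trans (norm_le_logsize _) _; rewrite ler_expR.
apply: (HB (fun t => logsize (y t)) n _ n (leqnn n)); split=> /=.
- by move=> t; exact: logsize_ge0.
- by apply: logsize_le_norm; apply: le_trans y0 (ler_norm _).
- move=> t tn; have [F' [[a' [_ [a'M -> F'E]]] _ yt]] := dyn t tn.
  have m0 : 0 <= b * logsize (y t) by rewrite mulr_ge0 ?logsize_ge0 ?(ltW b0).
  apply: (@logsize_absorb _ _ W (2 * M)) => //; rewrite ?mulr_ge0 ?ler0n ?lerDl//.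
  apply: le_trans yt _; rewrite addrC lerD2l FE F'E -mulrBl normrM.
  apply: ler_pM => //; last exact: phi_le (ltW b0).
  by apply: le_trans (ler_normB _ _) _; lra.
- move=> t s tn st; have [F' [[a' [_ [a'M -> F'E]]] fit yt]] := dyn t tn.
  set m := b * _; have m0 : 0 <= m by rewrite mulr_ge0 ?(ltW b0)// le_max lexx.
  apply: (@logsize_absorb _ _ (W + 2 * M) K) => //; first by lra.
  apply: le_trans yt _; rewrite addrC -addrA lerD2l FE F'E.
  apply: phi_of_expdiff => //; rewrite ?(ltW b0)//.
  rewrite (expdiff_same _ _ _ _ (logsize (y s))) normrM (ger0_norm (expR_ge0 _)) mulrC.
  apply: ler_pM => //; rewrite ?expR_ge0//; last first.
    by rewrite ler_expR ler_pM2l// le_max lexx orbT.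
  apply: (@expdiff_of_phi _ M) => //; first by rewrite /K; lra.
  by have := fit s st; rewrite FE F'E /K; lra.
Qed.

Lemma subcritical_stabilizable (R : realType) (W M bm Y : R) :
  0 <= W -> 0 <= M -> 0 < bm -> 4 * bm ^+ 2 < 27 ->
  stabilizable_from W (power_class M [set b | 0 <= b <= bm]) Y.
Proof.
move=> W0 M0 bm0 bm4; apply: certainty_equivalence.
have [eta eta0 bounded] := unknown_exponent_orbit_bounded bm0 bm4.
pose K := 2 * W + 2 * M; pose C := W + 2 * M + 2 * K + 2 * K / eta.
have K0 : 0 <= K by rewrite /K; lra.
have Ke : 0 <= 2 * K / eta by rewrite divr_ge0 ?(ltW eta0)//; lra.
have [|Bd HB] := bounded C `|Y| _ (normr_ge0 _); first by rewrite /C; lra.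
exists (expR Bd) => F y n [a [b [aM /andP[b0 bbm] FE]]] y0 dyn.
apply: le_trans (norm_le_logsize _) _; rewrite ler_expR.
have fits_lo t s F' a' b' : `|a'| <= M -> F' = (fun y => a' * phi b' y) -> (s < t)%N ->
    (forall s, (s < t)%N -> `|F (y s) - F' (y s)| <= 2 * W) ->
    `|expdiff a b a' b' (logsize (y s))| <= K.
  move=> a'M F'E st fit; apply: (@expdiff_of_phi _ M) => //; first by rewrite /K; lra.
  by have := fit s st; rewrite FE F'E /K; lra.
apply: (HB (fun t => logsize (y t)) n _ n (leqnn n)); split=> /=.
- by move=> t; exact: logsize_ge0.
- by apply: logsize_le_norm; apply: le_trans y0 (ler_norm _).
- move=> t tn; have [F' [[a' [b' [a'M /andP[b'0 b'bm] F'E]]] _ yt]] := dyn t tn.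
  have m0 : 0 <= bm * logsize (y t) by rewrite mulr_ge0 ?logsize_ge0// ltW.
  apply: (@logsize_absorb _ _ W (2 * M)) => //; rewrite ?mulr_ge0 ?ler0n//.
    by rewrite /C; lra.
  apply: le_trans yt _; rewrite addrC lerD2l.
  apply: le_trans (ler_normB _ _) _; rewrite FE F'E !(normrM _ (phi _ _)).
  have bnd (c d : R) : `|c| <= M -> 0 <= d -> d <= bm ->
      `|c| * `|phi d (y t)| <= M * expR (bm * logsize (y t)).
    move=> cM d0 dbm; apply: ler_pM => //; apply: le_trans (phi_le _ d0) _.
    by rewrite ler_expR ler_wpM2r// logsize_ge0.
  by have := bnd _ _ aM b0 bbm; have := bnd _ _ a'M b'0 b'bm; lra.
- move=> t lo hi tn lot hit xlo xhi lohi.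
  have [F' [[a' [b' [a'M /andP[b'0 b'bm] F'E]]] fit yt]] := dyn t tn.
  set m := bm * _; have m0 : 0 <= m by rewrite mulr_ge0 ?(ltW bm0)// subr_ge0.
  apply: (@le_trans _ _ (m + C)); last first.
    by rewrite lerD2r lerDl mulr_ge0 ?(ltW eta0) ?logsize_ge0.
  apply: (@logsize_absorb _ _ (W + 2 * M) (2 * K)) => //; rewrite ?mulr_ge0//; try lra.
    by rewrite /C; lra.
  apply: le_trans yt _; rewrite addrC -addrA lerD2l FE F'E.
  apply: phi_of_expdiff => //.
  apply: (expdiff_inter (K := K) b0 b'0 bbm b'bm _ _ xlo xhi lohi).
    exact: fits_lo a'M F'E lot fit.
  exact: fits_lo a'M F'E hit fit.
- move=> t lo hi tn lot hit xlohi xhi.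
  have [F' [[a' [b' [a'M /andP[b'0 b'bm] F'E]]] fit yt]] := dyn t tn.
  have xt0 := logsize_ge0 (y t).
  set m := _ + eta * _; have m0 : 0 <= m.
    by rewrite addr_ge0// mulr_ge0 ?(ltW bm0) ?(ltW eta0) ?logsize_ge0//; lra.
  apply: (@logsize_absorb _ _ (W + 2 * M) (2 * K / eta)) => //; try lra.
    by rewrite /C; lra.
  apply: le_trans yt _; rewrite addrC -addrA lerD2l FE F'E.
  apply: phi_of_expdiff => //.
  apply: le_trans (expdiff_extra (K := K) b0 b'0 bbm b'bm _ _ _ xlohi xhi) _.
  + exact: fits_lo a'M F'E lot fit.
  + exact: fits_lo a'M F'E hit fit.
  + exact: logsize_ge0.
  + rewrite -[leRHS]mulrA ler_wpM2l//; first by lra.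
    rewrite expRD [leLHS]mulrC [leRHS]mulrCA; apply: ler_wpM2l; first exact: expR_ge0.
    rewrite ler_pdivlMl//.
    by have := expR_ge1Dx (eta * logsize (y t)); lra.
Qed.

(** The first class is the single exponent [bm] with noise [W1].  Its law bounds the
    state by [B1], and [eps] is chosen so that exponents between [bm - eps]
    and [bm] give values that differ by at most [W1 - W] on that region.  The law depends on [Y] through [eps]. *)
Lemma critical_stabilizable (R : realType) (W M bm Y : R) :
  0 <= W -> 0 <= M -> 0 < bm -> bm < 4 -> 4 * bm ^+ 2 <= 27 ->
  stabilizable_from W (power_class M [set b | 0 < b <= bm]) Y.
Proof.
(* 2 * M covers the states of size below 1, and 1 the larger ones. *)
move=> W0 M0 bm0 bm4 bmc; pose W1 := W + 2 * M + 1.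
have W10 : 0 <= W1 by rewrite /W1; lra.
have [L1 [cL1 [B1 bL1]]] := @known_exponent_stabilizable _ W1 M bm Y W10 M0 bm0 bm4.
pose c := M * (`|B1| * expR (bm * `|B1|)).
have c0 : 0 <= c by rewrite !mulr_ge0// expR_ge0.
pose eps := Num.min (bm / 2) (1 + c)^-1.
have eps0 : 0 < eps by rewrite lt_min invr_gt0; apply/andP; split; lra.
have [eps1 eps2] : eps <= bm / 2 /\ eps <= (1 + c)^-1.
  by rewrite ge_min lexx ge_min lexx orbT.
apply: (@switching _ W W1 (power_class M [set bm])
  (power_class M [set b | 0 <= b <= bm - eps]) _ L1 Y B1 (M * expR (bm * B1))) => //.
- by rewrite /W1; lra.
- by exists (fun y => 0 * phi bm y), 0, bm; rewrite normr0.
- move=> F y [] FF yB; apply: power_class_crude FF yB => b /=.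
    by move=> ->; rewrite (ltW bm0) lexx.
  by move=> /andP[/ltW -> ->].
- move=> F [a [b [aM /andP[b0 bbm] FE]]].
  have [be|be] := leP b (bm - eps).
    by left; exists a, b; split=> //=; rewrite (ltW b0).
  right; exists (fun y => a * phi bm y); first by exists a, bm.
  move=> y yB; rewrite FE /W1.
  have [y1|/ltW y1] := leP 1 `|y|; last first.
    by have := phi_diff_small (ltW b0) (ltW bm0) aM aM y1; lra.
  rewrite phi_diff_expdiff// /expdiff -mulrBr normrM distrC.
  have x0 := logsize_ge0 y.
  have xB : logsize y <= `|B1| by apply: logsize_le_norm; apply: le_trans yB (ler_norm _).
  have d0 : 0 <= expR (bm * logsize y) - expR (b * logsize y).
    by rewrite subr_ge0 ler_expR ler_wpM2r.
  rewrite (ger0_norm d0).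
  have h1 : expR (bm * logsize y) - expR (b * logsize y) <=
      eps * (`|B1| * expR (bm * `|B1|)).
    apply: le_trans (expR_sub_le _ _) _; rewrite -mulrBl -mulrA.
    apply: ler_pM; rewrite ?mulr_ge0 ?expR_ge0 ?subr_ge0//; first by lra.
    by apply: ler_pM; rewrite ?expR_ge0// ler_expR ler_wpM2l// ltW.
  have h2 := ler_pM (normr_ge0 a) d0 aM h1.
  have h3 : eps * c <= 1.
    apply: le_trans (ler_wpM2r c0 eps2) _.
    by rewrite mulrC ler_pdivrMr; lra.
  rewrite mulrCA -/c in h2; lra.
- apply: subcritical_stabilizable => //; first by lra.
  apply: lt_le_trans bmc; rewrite ltr_pM2l// ltr_pXn2r// ?nnegrE; lra.
Qed.

(** The exponents are tried one after the other; a wrong hypothesis does no harm as long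
    as the data do not refute it. *)
Lemma finite_exponents_stabilizable (R : realType) (W M Y : R) (Bs : set R) :
  0 <= W -> 0 <= M -> finite_set Bs -> (forall b, Bs b -> 0 < b < 4) ->
  stabilizable_from W (power_class M Bs) Y.
Proof.
move=> W0 M0 /finite_seqP[s ->]; elim: s Y => [|b s IHs] Y Bs4.
  exists (fun _ _ => 0); split=> //; exists 0 => F y n [a [b []]].
  by rewrite /= in_nil.
have /andP[b0 b4] : 0 < b < 4 by apply: Bs4; rewrite /= mem_head.
have [L1 [cL1 [B1 bL1]]] := @known_exponent_stabilizable _ W M b Y W0 M0 b0 b4.
apply: (@switching _ W W (power_class M [set b]) (power_class M [set` s])
   _ L1 Y B1 (M * expR (4 * B1))) => //.
- by exists (fun y => 0 * phi b y), 0, b; rewrite normr0.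
- move=> F y [] FF yB; apply: power_class_crude FF yB => b' /=.
    by move=> ->; rewrite !ltW.
  by move=> b's; have /andP[/ltW -> /ltW ->] := Bs4 b' b's.
- move=> F [a [b' [aM b's FE]]]; move: b's; rewrite /= in_cons => /predU1P[bb|b's].
    by right; exists F => [|y _]; [exists a, b|rewrite subrr normr0 subrr]; rewrite -?bb.
  by left; exists a, b'.
- by apply: IHs => b' b's; apply: Bs4; rewrite /= in_cons [_ \in s]b's orbT.
Qed.

(** The known term [g0] is cancelled by the input. *)
Lemma stabilizing_feedback (R : realType) (q : nat) (W : R) (g0 : R -> R)
    (A B : 'rV[R]_q -> R) (Xi : set 'rV[R]_q) (Fs : set (R -> R)) :
  (forall xi, Xi xi -> Fs (fun y => A xi * phi (B xi) y)) ->
  (forall Y, stabilizable_from W Fs Y) ->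
  robustly_stabilizable W g0 A B Xi /\ uniformly_robustly_stabilizable W g0 A B Xi.
Proof.
move=> sub /law_for_all_starts [L [cL bL]].
pose mu : feedback R := fun t v => L (fun i => v ord0 (inord i)) t - g0 (v ord0 ord_max).
have key xi w y t Y : Xi xi -> admissible_disturbance W w ->
    closed_loop g0 A B mu xi w y -> `|y 0%N| <= Y ->
    forall Bd, bounds W Fs L Y Bd -> `|y t| <= Bd.
  move=> Xxi Ww cl y0 Bd bd; apply: (bd _ y t (sub _ Xxi) y0) => s _.
  rewrite cl /mu mxE /= (cL _ y) => [|i is_]; last by rewrite mxE inordK.
  rewrite (_ : _ - _ - _ = w s.+1); first exact: Ww.
  by ring.
split; exists mu.
  move=> xi w y Xxi Ww cl; have [Bd bd] := bL `|y 0%N|.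
  by exists Bd => _ [t _ <-]; exact: key cl _ _ bd.
move=> Y _; have [Bd bd] := bL Y.
by exists Bd => _ [xi [w [y [t [Xxi Ww cl y0 ->]]]]]; exact: key cl y0 _ bd.
Qed.

Lemma within_compact_bounded (R : realType) (q : nat) (f : 'rV[R]_q -> R) (Xi : set 'rV[R]_q) :
  compact Xi -> {within Xi, continuous f} -> exists2 M, 0 <= M & forall xi, Xi xi -> `|f xi| <= M.
Proof.
move=> cXi cf; have /compact_bounded[M [Mr HM]] := continuous_compact cf cXi.
exists (`|M| + 1); first by rewrite addr_ge0.
move=> xi Xxi; apply: (HM (`|M| + 1)); last by exists xi.
by apply: le_lt_trans (ler_norm _) _; rewrite ltrDl.
Qed.

(** * The pencil of lines kept by the adversary *)

(** The numbers [a t - 2 C / 2 ^ t] increase and [a t + 2 C / 2 ^ t] decrease; the limit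
    is the supremum of the former. *)
Lemma geometric_limit (R : realType) (a : nat -> R) (C : R) :
  (forall t, `|a t.+1 - a t| <= C * 2^-1 ^+ t) ->
  exists l, forall t, `|l - a t| <= 2 * C * 2^-1 ^+ t.
Proof.
move=> H; pose D t := 2 * C * 2^-1 ^+ t.
have DS t : D t = D t.+1 + C * 2^-1 ^+ t by rewrite /D exprS; field.
have C0 : 0 <= C by have := H 0%N; rewrite expr0 mulr1; apply: le_trans.
have D0 t : 0 <= D t by rewrite /D !mulr_ge0// exprn_ge0.
have near t k : `|a (t + k)%N - a t| <= D t - D (t + k)%N.
  elim: k => [|k IHk]; first by rewrite addn0 !subrr normr0.
  rewrite addnS; have := H (t + k)%N; have := DS (t + k)%N => e h.
  rewrite (_ : _ - _ = (a (t + k).+1 - a (t + k)%N) + (a (t + k)%N - a t)); last by ring.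
  by apply: le_trans (ler_normD _ _) _; lra.
have nearW t k : `|a (t + k)%N - a t| <= D t.
  by apply: le_trans (near t k) _; rewrite lerBlDr lerDl.
have ub t u : a t - D t <= a u + D u.
  have [tu|/ltnW ut] := leqP t u.
    have := nearW t (u - t)%N; rewrite subnKC// => /ler_normlP[h1 h2].
    by have := D0 u; lra.
  have := nearW u (t - u)%N; rewrite subnKC// => /ler_normlP[h1 h2].
  by have := D0 t; lra.
pose S : set R := [set a t - D t | t in [set: nat]].
exists (sup S) => t; apply/ler_normlP; split; last first.
  rewrite lerBlDl; apply: ge_sup; first by exists (a 0%N - D 0%N), 0%N.
  by move=> _ [u _ <-]; exact: ub.
rewrite opprB lerBlDl -lerBlDr; apply: ub_le_sup; last by exists t.
by exists (a 0%N + D 0%N) => _ [u _ <-]; exact: ub.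
Qed.

Lemma half_pow_small (R : realType) (K e : R) : 0 <= K -> 0 < e ->
  exists T, forall T', (T <= T')%N -> K * 2^-1 ^+ T' <= e.
Proof.
move=> K0 e0; exists (Num.trunc (K / e)).+1 => T' TT'.
have h : K / e <= T'%:R.
  by apply: le_trans (ltW (truncnS_gt _)) _; rewrite ler_nat.
rewrite exprVn ler_pdivrMr ?exprn_gt0// mulrC -ler_pdivrMr//.
apply: le_trans h _; rewrite -natrX ler_nat; apply: ltnW; exact: ltn_expl.
Qed.

Lemma sqrt3_sqr (R : realType) : (Num.sqrt 3 : R) ^+ 2 = 3.
Proof. by rewrite sqr_sqrtr. Qed.

Lemma sqrt3_ge (R : realType) : 3 / 2 <= (Num.sqrt 3 : R).
Proof. by rewrite -ler_sqr ?nnegrE ?sqrtr_ge0// sqrt3_sqr; lra. Qed.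

(** At time [t] the adversary considers the line [al t + be t * x], an estimate of
    [ln a + b x], and the two lines obtained from it by the slopes [be t +- tilt t] with
    pivot [logpoint t.+1], the logarithm of [|y (t - 1)|].  It continues with one of them,
    chosen by the sign [s t], without any noise. *)
Section PivotingLines.
Context (R : realType) (b0 al0 r c B X : R) (y al be s : nat -> R).

(** The index is shifted by two, with two leading zeros, so that the general step also
    covers the first two moves. *)
Definition logpoint (t : nat) : R := if t is u.+2 then ln `|y u| else 0.
Local Notation z := logpoint.
(** Chosen so that the change of the line at all earlier points is at most [c] times
    [expR (- (B * logpoint t))], the precision of the measurement at [logpoint t]. *)
Definition tilt (t : nat) : R := c * expR (- (B * z t)) / Num.max 1 (z t.+1).

Hypotheses (r_gt0 : 0 < r) (c_gt0 : 0 < c) (cr : 4 * c <= r).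
Hypotheses (supercritical : Num.sqrt 3 + 2 * r <= 2 / 3 * b0) (BE : B = b0 + 2 * r).
Hypotheses (X_ge2 : 2 <= X) (X_c : r - al0 - ln (c / 4) <= r / 3 * X).
Hypotheses (y_init : y 0%N = expR X) (al_init : al 0%N = al0) (be_init : be 0%N = b0).
Hypothesis s_norm : forall t, `|s t| = 1.
Hypothesis al_next : forall t, al t.+1 = al t - s t * tilt t * z t.+1.
Hypothesis be_next : forall t, be t.+1 = be t + s t * tilt t.
Hypothesis y_next : forall t, y t != 0 ->
  let v := tilt t * (z t.+2 - z t.+1) in
  expR (al t + be t * z t.+2) * (expR v - expR (- v)) / 2 <= `|y t.+1|.

(** [inv_al] and [inv_be] keep the lines near [al0 + b0 * x]; the other fields describe
    the growth that results, and [inv_exp] makes the changes of the lines summable. *)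
Record pivot_invariant (t : nat) : Prop := PivotInvariant {
  inv_ratio : Num.sqrt 3 * z t.+1 <= z t.+2;
  inv_ratio2 : 3 * z t <= z t.+2;
  inv_large : X <= z t.+2;
  inv_prev : z t.+1 = 0 \/ X <= z t.+1;
  inv_time : t%:R <= z t.+1;
  inv_exp : expR (- (B * z t)) <= 2 * 2^-1 ^+ t;
  inv_al : `|al t - al0| <= c * (4 - 4 * 2^-1 ^+ t);
  inv_be : `|be t - b0| <= c * (4 - 4 * 2^-1 ^+ t) }.

Lemma tilt_ge0 t : 0 <= tilt t.
Proof.
by rewrite /tilt divr_ge0 ?mulr_ge0 ?expR_ge0 ?(ltW c_gt0)// le_max ler01.
Qed.

Lemma tilt_max t : tilt t * Num.max 1 (z t.+1) = c * expR (- (B * z t)).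
Proof. by rewrite /tilt divfK// gt_eqF// lt_max ltr01. Qed.

Lemma b0_ge1 : 1 <= b0.
Proof. by have := sqrt3_ge R; move: r_gt0 supercritical => ? ?; lra. Qed.

Lemma exp_decay (v : R) (t : nat) : t%:R <= v -> expR (- (B * v)) <= 2^-1 ^+ t.
Proof.
move=> tv; have v0 : 0 <= v by apply: le_trans tv.
apply: (@le_trans _ _ (expR (- t%:R))).
  rewrite ler_expR lerN2; apply: le_trans tv _.
  have B1 : 1 <= B by rewrite BE; have := b0_ge1; move: r_gt0 => ? ?; lra.
  exact: ler_peMl.
rewrite expRN exprVn lef_pV2 ?posrE ?expR_gt0 ?exprn_gt0//.
rewrite -[t%:R]mul1r expRM_natr; apply: lerXn2r; rewrite ?nnegrE ?expR_ge0//.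
by have := expR_ge1Dx (1 : R); lra.
Qed.

(** The next point is at least about [(b0 - r) x - B x / 3], where the earlier point
    [logpoint t] is at most [x / 3] as two ratios have been at least [sqrt 3].  Because
    [2 / 3 * b0 > sqrt 3] this is at least [sqrt 3 * x] once [X] exceeds the constants. *)
Lemma pivot_invariantP t : pivot_invariant t.
Proof.
have s3 := sqrt3_ge R; have b01 := b0_ge1.
have B0 : 0 <= B by rewrite BE; move: r_gt0 => ?; lra.
elim: t => [|t IHt].
  have z2 : z 2%N = X by rewrite /= y_init ger0_norm ?expR_ge0// expRK.
  split; rewrite ?z2 ?al_init ?be_init ?subrr ?normr0 ?expr0 ?mulr0 ?oppr0 ?expR0//=;
    try (by left); move: X_ge2 c_gt0 => ? ?; lra.
have [rat rat2 large prev time exp ial ibe] := IHt.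
set x := z t.+2 in rat rat2 large *; set z' := z t.+1 in rat prev time *.
have h0 : 0 <= 2^-1 ^+ t :> R by rewrite exprn_ge0.
have half : 2^-1 ^+ t.+1 = 2^-1 ^+ t / 2 :> R by rewrite exprS mulrC.
have yt0 : y t != 0.
  apply: contraTneq large => yt; rewrite /x /= yt normr0 ln0 //.
  by rewrite -ltNge; move: X_ge2 => ?; lra.
have z'0 : 0 <= z' by case: prev => [->//|h]; move: X_ge2 => ?; lra.
have gap : Num.max 1 z' / 2 <= x - z'.
  rewrite ler_pdivrMr// ge_max; case: prev => [z'E|Xz'].
    by rewrite z'E; move: X_ge2 => ?; apply/andP; split; lra.
  have : 3 / 2 * z' <= Num.sqrt 3 * z' by rewrite ler_wpM2r.
  by move: X_ge2 => ? ?; apply/andP; split; lra.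
have m1 : 1 <= Num.max 1 z' by rewrite le_max lexx.
have mz : z' <= Num.max 1 z' by rewrite le_max lexx orbT.
have tm := tilt_max t; rewrite -/z' in tm.
have t0 := tilt_ge0 t.
have ex0 := expR_ge0 (- (B * z t)).
have ce : c * expR (- (B * z t)) <= 2 * c * 2^-1 ^+ t.
  by rewrite -mulrA mulrCA ler_pM2l.
have tle1 : tilt t <= 2 * c * 2^-1 ^+ t.
  by apply: le_trans ce; rewrite -tm ler_peMr.
have tlez : tilt t * z' <= 2 * c * 2^-1 ^+ t.
  by apply: le_trans ce; rewrite -tm ler_wpM2l.
have cle : c * (4 - 4 * 2^-1 ^+ t) <= r.
  have := mulr_ge0 (ltW c_gt0) h0; move: cr => ? ?; lra.
have vge : c * expR (- (B * z t)) / 2 <= tilt t * (x - z').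
  by rewrite -tm -mulrA ler_wpM2l.
have grow : expR (Num.sqrt 3 * x) <= `|y t.+1|.
  apply: le_trans (y_next yt0); rewrite -/x -/z' /=.
  set v := tilt t * _ in vge *.
  have v0 : 0 <= v by apply: le_trans vge; rewrite divr_ge0// mulr_ge0// ltW.
  have v1 : v <= expR v - expR (- v).
    have := expR_ge1Dx v; have : expR (- v) <= 1 by rewrite expR_le1 oppr_le0.
    lra.
  set L := al t + _.
  have c4 : expR (ln (c / 4)) = c / 4 by rewrite lnK// posrE divr_gt0.
  apply: (@le_trans _ _ (expR (L - B * z t + ln (c / 4)))).
    rewrite ler_expR /L.
    have Bz : B * z t <= B * (x / 3) by rewrite ler_wpM2l//; lra.
    have x0 : 0 <= x by move: X_ge2 => ?; lra.
    have /ler_normlP[al1 _] := ial; have /ler_normlP[be1 _] := ibe.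
    have bex : (b0 - r) * x <= be t * x by rewrite ler_wpM2r//; lra.
    have rX : r / 3 * X <= r / 3 * x by rewrite ler_pM2l// divr_gt0.
    have sx : (Num.sqrt 3 + 2 * r) * x <= 2 / 3 * b0 * x by rewrite ler_wpM2r.
    by rewrite BE in Bz *; move: X_c => ?; lra.
  rewrite expRD c4 expRD -!mulrA ler_pM2l ?expR_gt0//.
  apply: (@le_trans _ _ (v / 2)); last by rewrite ler_pM2r.
  by rewrite mulrA [_ * c]mulrC; lra.
have ratn : Num.sqrt 3 * x <= z t.+3.
  rewrite [z t.+3]/= -ler_expR lnK//.
  by rewrite posrE; apply: lt_le_trans grow; exact: expR_gt0.
have xn : x <= Num.sqrt 3 * x.
  by rewrite ler_peMl//; move: X_ge2 => ?; lra.
have time' : t.+1%:R <= x.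
  rewrite -natr1; apply: le_trans (_ : z' + 1 <= _); first by rewrite lerD2r.
  case: prev => [z'E|Xz']; first by rewrite z'E; move: X_ge2 => ?; lra.
  have : 3 / 2 * z' <= Num.sqrt 3 * z' by rewrite ler_wpM2r.
  by move: X_ge2 => ? ?; lra.
split=> //; rewrite -/x -/z'.
- apply: le_trans ratn; have : Num.sqrt 3 * (Num.sqrt 3 * z') <= Num.sqrt 3 * x.
    by rewrite ler_wpM2l//; lra.
  by rewrite mulrA -expr2 sqrt3_sqr.
- by apply: le_trans large (le_trans xn ratn).
- by right.
- by rewrite half mulrCA divff// mulr1; exact: exp_decay.
- rewrite al_next half -/z'.
  rewrite (_ : _ - al0 = (al t - al0) - s t * tilt t * z'); last by ring.
  apply: le_trans (ler_normB _ _) _.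
  rewrite (normrM (s t * _)) (normrM (s t)) s_norm mul1r (ger0_norm t0) (ger0_norm z'0).
  lra.
- rewrite be_next half.
  rewrite (_ : _ - b0 = (be t - b0) + s t * tilt t); last by ring.
  apply: le_trans (ler_normD _ _) _.
  rewrite (normrM (s t)) s_norm mul1r (ger0_norm t0); lra.
Qed.

Lemma logpoint_step t : z t.+2 + 1 <= z t.+3.
Proof.
have [_ _ large _ _ _ _ _] := pivot_invariantP t.
have [rat _ _ _ _ _ _ _] := pivot_invariantP t.+1.
have : 3 / 2 * z t.+2 <= Num.sqrt 3 * z t.+2.
  by rewrite ler_wpM2r ?sqrt3_ge//; move: X_ge2 => ?; lra.
by move: X_ge2 => ? ?; lra.
Qed.

Lemma logpoint_far t k : z t.+2 + k%:R <= z (t + k).+2.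
Proof.
elim: k => [|k IHk]; first by rewrite addn0 addr0.
by have := logpoint_step (t + k); rewrite addnS -natr1; lra.
Qed.

(** The line of time [t.+2] is obtained with pivot at the point [logpoint t.+2] itself;
    later pivots lie farther out, but their tilts decay geometrically. *)
Lemma later_lines_agree t k :
  `|(al (t.+1 + k) + be (t.+1 + k) * z t.+2) - (al t.+1 + be t.+1 * z t.+2)|
    <= 2 * c * expR (- (B * z t.+2)).
Proof.
have B0 : 1 <= B by rewrite BE; have := b0_ge1; move: r_gt0 => ? ?; lra.
set E := expR (- (B * z t.+2)); have E0 : 0 <= E := expR_ge0 _.
suff : `|(al (t.+1 + k) + be (t.+1 + k) * z t.+2) - (al t.+1 + be t.+1 * z t.+2)|
    <= c * E * (2 - 4 * 2^-1 ^+ k * (k != 0%N)%:R).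
  move/le_trans; apply; rewrite -mulrA [_ * E]mulrC mulrCA !mulrA.
  have : 0 <= c * E * (4 * 2^-1 ^+ k * (k != 0%N)%:R).
    by rewrite !mulr_ge0 ?exprn_ge0// ltW.
  lra.
elim: k => [|k IHk].
  rewrite addn0 subrr normr0 eqxx mulr0 subr0 !mulr_ge0//; exact: ltW.
rewrite addnS al_next be_next.
set n := (t.+1 + k)%N in IHk *.
rewrite (_ : _ - _ = (al n + be n * z t.+2 - (al t.+1 + be t.+1 * z t.+2))
     + s n * tilt n * (z t.+2 - z n.+1)); last by ring.
apply: le_trans (ler_normD _ _) _; rewrite (normrM (s n * _)) (normrM (s n)) s_norm mul1r (ger0_norm (tilt_ge0 _)).
case: k @n IHk => [|k] n IHk.
  have -> : n = t.+1 by rewrite /n addn0.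
  rewrite !subrr normr0 mulr0 addr0 expr1 mulr1 (_ : 2 - _ = 0) ?mulr0//.
  by field.
have nE : n = (t + k).+2 by rewrite /n addSn addnS.
have far := logpoint_far t k.
have n1 : z t.+2 <= z n.+1.
  have := logpoint_far t k.+1; rewrite addnS -nE; have : 0 <= k.+1%:R :> R by []. lra.
have zt0 : 0 <= z t.+2.
  by have [_ _ large _ _ _ _ _] := pivot_invariantP t; move: X_ge2 => ?; lra.
have small : tilt n * `|z t.+2 - z n.+1| <= c * E * 2^-1 ^+ k.
  apply: (@le_trans _ _ (tilt n * Num.max 1 (z n.+1))).
    rewrite ler_wpM2l ?tilt_ge0// distrC ger0_norm ?subr_ge0//.
    by rewrite le_max; apply/orP; right; lra.
  rewrite tilt_max -mulrA ler_pM2l// {1}nE.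
  apply: (@le_trans _ _ (expR (- (B * (z t.+2 + k%:R))))).
    by rewrite ler_expR lerN2 ler_wpM2l//; lra.
  by rewrite mulrDr opprD expRD ler_wpM2l// exp_decay.
rewrite /= mulr1 !exprS in IHk *; lra.
Qed.
End PivotingLines.

(** * A strategy that defeats every feedback law *)

(** Whatever the input, one of the two tilted lines leads to a state of size at least
    half the difference of the two predictions. *)
Lemma pivoting_strategy (R : realType) (kappa b0 al0 c B X : R) (u : law R) :
  `|kappa| = 1 -> causal u ->
  exists y al be s : nat -> R,
   [/\ y 0%N = expR X, al 0%N = al0, be 0%N = b0, forall t, `|s t| = 1 &
    forall t, [/\ al t.+1 = al t - s t * tilt c B y t * logpoint y t.+1,
      be t.+1 = be t + s t * tilt c B y t,
      y t.+1 = kappa * Num.sg (y t) * expR (al t.+1 + be t.+1 * ln `|y t|) + u y t &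
      y t != 0 -> let v := tilt c B y t * (logpoint y t.+2 - logpoint y t.+1) in
        expR (al t + be t * logpoint y t.+2) * (expR v - expR (- v)) / 2 <= `|y t.+1|]].
Proof.
move=> kap cu; pose T := (R * R * R * R)%type.
pose Y (v : nat -> T) i := (v i).1.1.1.
pose nal (v : nat -> T) t s := (v t).1.1.2 - s * tilt c B (Y v) t * logpoint (Y v) t.+1.
pose nbe (v : nat -> T) t s := (v t).1.2 + s * tilt c B (Y v) t.
pose ny (v : nat -> T) t s :=
  kappa * Num.sg (Y v t) * expR (nal v t s + nbe v t s * ln `|Y v t|) + u (Y v) t.
pose sgn (v : nat -> T) t : R := if `|ny v t (- 1)| <= `|ny v t 1| then 1 else - 1.
pose step (v : nat -> T) t : T := if t is t'.+1 then
  (ny v t' (sgn v t'), nal v t' (sgn v t'), nbe v t' (sgn v t'), sgn v t')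
  else (expR X, al0, b0, 1).
have [|v vE] := @course_of_values T (0, 0, 0, 0) step.
  move=> v v' [//|t] vv'; rewrite /step.
  have YY i : (i <= t)%N -> Y v i = Y v' i by move=> it; rewrite /Y vv'.
  have zz i : (i <= t.+1)%N -> logpoint (Y v) i = logpoint (Y v') i.
    by case: i => [//|[//|i]]; rewrite ltnS => it; rewrite /= YY// ltnW.
  have tt : tilt c B (Y v) t = tilt c B (Y v') t by rewrite /tilt !zz.
  have ealE s : nal v t s = nal v' t s by rewrite /nal tt zz// vv'.
  have ebeE s : nbe v t s = nbe v' t s by rewrite /nbe tt vv'.
  have enyE s : ny v t s = ny v' t s.
    by rewrite /ny ealE ebeE YY// (cu _ _ t YY).
  by rewrite /sgn !enyE ealE ebeE.
exists (Y v), (fun t => (v t).1.1.2), (fun t => (v t).1.2), (sgn v).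
rewrite {1}/Y (vE 0%N); split=> // [t|t]; first by rewrite /sgn; case: ifP; rewrite ?normrN normr1.
rewrite /Y (vE t.+1) /= -/(Y v t); split=> // yt0.
pose w := tilt c B (Y v) t * (logpoint (Y v) t.+2 - logpoint (Y v) t.+1).
change (expR ((v t).1.1.2 + (v t).1.2 * ln `|Y v t|) * (expR w - expR (- w)) / 2
  <= `|ny v t (sgn v t)|).
have up : `|ny v t 1| <= `|ny v t (sgn v t)| /\ `|ny v t (- 1)| <= `|ny v t (sgn v t)|.
  rewrite /sgn; case: ifP => // /negbT; rewrite -ltNge => h.
  by rewrite lexx (ltW h).
have diff : ny v t 1 - ny v t (- 1) = kappa * Num.sg (Y v t) *
    (expR ((v t).1.1.2 + (v t).1.2 * ln `|Y v t|) * (expR w - expR (- w))).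
  have E z : expR (nal v t z + nbe v t z * ln `|Y v t|) =
      expR ((v t).1.1.2 + (v t).1.2 * ln `|Y v t|) * expR (z * w).
    rewrite -expRD /nal /nbe /w /Y /=; congr expR; ring.
  by rewrite /ny !E mul1r mulN1r; ring.
have : `|ny v t 1 - ny v t (- 1)| <= 2 * `|ny v t (sgn v t)|.
  by apply: le_trans (ler_normB _ _) _; case: up; lra.
rewrite diff (normrM (kappa * _)) (normrM kappa) kap normr_sg yt0 !mul1r.
by move/(le_trans (ler_norm _)); lra.
Qed.

(** The true parameters are the limit of the lines.  The noise is the difference between
    the limit and the line used at each step, which is at most [W] at the point where
    that step is taken. *)
Theorem adversary_wins (R : realType) (W b0 al0 r kappa : R) (u : law R) :
  0 < W -> 0 < r -> Num.sqrt 3 + 2 * r <= 2 / 3 * b0 -> `|kappa| = 1 -> causal u ->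
  exists al be y, [/\ `|al - al0| <= r, `|be - b0| <= r,
    forall n, trajectory W (fun v => kappa * expR al * phi be v) u y n &
    forall V, exists t, V < `|y t|].
Proof.
move=> W0 r0 sup kap cu.
pose c := Num.min (r / 4) (W / 3).
have c0 : 0 < c by rewrite lt_min; apply/andP; split; lra.
have [c1 c2] : c <= r / 4 /\ c <= W / 3 by rewrite ge_min lexx ge_min lexx orbT.
have cr : 4 * c <= r by lra.
pose B := b0 + 2 * r.
pose X := 2 + `|al0 + r| / r + `|r - al0 - ln (c / 4)| / (r / 3).
have n1 : 0 <= `|al0 + r| / r by rewrite divr_ge0// ltW.
have n2 : 0 <= `|r - al0 - ln (c / 4)| / (r / 3) by rewrite !divr_ge0// ltW.
have X2 : 2 <= X by rewrite /X; lra.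
have Xal : al0 + r <= r * X.
  apply: le_trans (ler_norm _) _; rewrite mulrC -ler_pdivrMr// /X; lra.
have Xc : r - al0 - ln (c / 4) <= r / 3 * X.
  apply: le_trans (ler_norm _) _; rewrite [leRHS]mulrC -ler_pdivrMr ?divr_gt0// /X; lra.
have [y [al [be [s [yi ali bei sn nxt]]]]] := pivoting_strategy b0 al0 c B X kap cu.
have aln t := let: And4 h _ _ _ := nxt t in h.
have ben t := let: And4 _ h _ _ := nxt t in h.
have yn t := let: And4 _ _ h _ := nxt t in h.
have yg t := let: And4 _ _ _ h := nxt t in h.
have inv := pivot_invariantP r0 c0 cr sup erefl X2 Xc yi ali bei sn aln ben yg.
have agree := later_lines_agree r0 c0 cr sup erefl X2 Xc yi ali bei sn aln ben yg.
have tpos t := tilt_ge0 B y c0 t.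
have decay t : tilt c B y t * Num.max 1 (logpoint y t.+1) <= 2 * c * 2^-1 ^+ t.
  rewrite tilt_max -mulrA mulrCA ler_pM2l//; exact: inv_exp (inv t).
have zpos t : 0 <= logpoint y t.+1.
  by case: (inv_prev (inv t)) => [->//|]; lra.
have ald t : `|al t.+1 - al t| <= 2 * c * 2^-1 ^+ t.
  rewrite aln addrAC subrr add0r normrN (normrM (s t * _)) (normrM (s t)) sn mul1r.
  rewrite (ger0_norm (tpos t)) (ger0_norm (zpos t)); apply: le_trans (decay t).
  by rewrite ler_wpM2l// le_max lexx orbT.
have bed t : `|be t.+1 - be t| <= 2 * c * 2^-1 ^+ t.
  rewrite ben addrAC subrr add0r (normrM (s t)) sn mul1r (ger0_norm (tpos t)).
  by apply: le_trans (decay t); rewrite ler_peMr// le_max lexx.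
have [al_ alP] := geometric_limit ald; have [be_ beP] := geometric_limit bed.
have big t : X <= ln `|y t| := inv_large (inv t).
have al_r : `|al_ - al0| <= r by have := alP 0%N; rewrite ali expr0; lra.
have be_r : `|be_ - b0| <= r by have := beP 0%N; rewrite bei expr0; lra.
have y0 t : 0 < `|y t|.
  by rewrite ltNge; apply/negP => /ln0 E; have := big t; rewrite E; lra.
exists al_, be_, y; split=> //.
- move=> n t _; set x := ln `|y t|; have Xx : X <= x := big t.
  have x0 : 0 <= x by lra.
  have y1 : 1 <= `|y t| by rewrite -(lnK (y0 t)) -/x -expR0 ler_expR.
  rewrite phi_large// /logsize (max_idPr y1) -/x.
  rewrite (_ : kappa * _ * _ = kappa * Num.sg (y t) * expR (al_ + be_ * x)); last first.
    by rewrite expRD; ring.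
  rewrite yn -/x addrAC addrK -mulrBr normrM normrM kap normr_sg -normr_gt0 y0 !mul1r.
  set p := al t.+1 + _; set q := al_ + _.
  have E0 := expR_gt0 (- (B * x)).
  have pq : `|q - p| <= 3 * c * expR (- (B * x)).
    have K0 : 0 <= 4 * c * (1 + x) by rewrite !mulr_ge0 ?(ltW c0) ?addr_ge0.
    (* The limit line is compared with the line used at this step through a line of a
       time m so late that it is indistinguishable from the limit. *)
    have [T TP] := half_pow_small K0 (mulr_gt0 c0 E0).
    set m := (t.+1 + T)%N.
    have Tm := TP m (leq_addl _ _).
    have e1 : `|al_ - al m| <= 4 * c * 2^-1 ^+ m by have := alP m; lra.
    have e2 : `|(be_ - be m) * x| <= 4 * c * 2^-1 ^+ m * x.
      by rewrite normrM (ger0_norm x0) ler_wpM2r//; have := beP m; lra.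
    rewrite (_ : q - p = (al_ - al m) + (be_ - be m) * x + (al m + be m * x - p));
      last by rewrite /q; ring.
    apply: le_trans (ler_normD _ _) _; have := ler_normD (al_ - al m) ((be_ - be m) * x).
    by have := agree t T; rewrite -/m -/p; lra.
  have rx : r * X <= r * x by rewrite ler_pM2l.
  have qB : q <= B * x.
    move: al_r be_r => /ler_normlP[_ h1] /ler_normlP[_ h2].
    have : be_ * x <= (b0 + r) * x by rewrite ler_wpM2r//; lra.
    by rewrite /q /B; lra.
  have pB : p <= B * x.
    have /ler_normlP[_ h1] := inv_al (inv t.+1); have /ler_normlP[_ h2] := inv_be (inv t.+1).
    have h0 : 0 <= c * 2^-1 ^+ t.+1 by rewrite mulr_ge0 ?exprn_ge0// ltW.
    have : be t.+1 * x <= (b0 + r) * x by rewrite ler_wpM2r//; lra.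
    by rewrite /p /B; lra.
  have lip v w : v <= B * x -> w <= B * x -> `|v - w| <= 3 * c * expR (- (B * x)) ->
      expR v - expR w <= W.
    move=> vB wB vw; apply: le_trans (expR_sub_le _ _) _.
    apply: (@le_trans _ _ (3 * c * expR (- (B * x)) * expR (B * x))); last first.
      by rewrite -mulrA -expRD addNr expR0; lra.
    apply: (@le_trans _ _ (`|v - w| * expR v)).
      by rewrite ler_wpM2r ?expR_ge0// ler_norm.
    by rewrite ler_pM ?normr_ge0 ?expR_ge0// ler_expR.
  apply/ler_normlP; split; last by apply: lip => //; rewrite distrC.
  by rewrite opprB; apply: lip.
- move=> V; exists (Num.trunc `|V|); apply: le_lt_trans (ler_norm _) _.
  apply: lt_le_trans (truncnS_gt _) _.
  have := inv_time (inv (Num.trunc `|V|).+1); rewrite /=.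
  move/le_trans; apply; rewrite -[leRHS](lnK (y0 _)).
  by have := expR_ge1Dx (ln `|y (Num.trunc `|V|)|); lra.
Qed.

(** * Images of maps of rank two *)

(** The iteration [p - (h p - c)] for [h = (f, g)] contracts by 1/2 in the norm
    [|s| + |r|], and its first step has length at most [d / 2], so it stays in the
    square. *)
Lemma near_identity_onto (R : realType) (f g : R -> R -> R) (d c1 c2 : R) :
  0 < d ->
  (forall s r s' r', `|s| <= d -> `|r| <= d -> `|s'| <= d -> `|r'| <= d ->
     `|(f s r - s) - (f s' r' - s')| <= (`|s - s'| + `|r - r'|) / 4 /\
     `|(g s r - r) - (g s' r' - r')| <= (`|s - s'| + `|r - r'|) / 4) ->
  `|c1 - f 0 0| + `|c2 - g 0 0| <= d / 2 ->
  exists s r, [/\ `|s| <= d, `|r| <= d, f s r = c1 & g s r = c2].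
Proof.
move=> d0 con cd.
pose P n := iter n (fun p : R * R => (p.1 - (f p.1 p.2 - c1), p.2 - (g p.1 p.2 - c2))) (0, 0).
have P1 n : (P n.+1).1 = (P n).1 - (f (P n).1 (P n).2 - c1) by [].
have P2 n : (P n.+1).2 = (P n).2 - (g (P n).1 (P n).2 - c2) by [].
have h0 n : 0 <= d * 2^-1 ^+ n by rewrite mulr_ge0 ?exprn_ge0// ltW.
have hS n : d * 2^-1 ^+ n.+1 = d * 2^-1 ^+ n / 2 by rewrite exprS; field.
have inv n : `|(P n).1| + `|(P n).2| <= d - d * 2^-1 ^+ n /\
    `|(P n.+1).1 - (P n).1| + `|(P n.+1).2 - (P n).2| <= d * 2^-1 ^+ n / 2.
  elim: n => [|n [IH1 IH2]].
    rewrite P1 P2 /= normr0 expr0 addr0 mulr1 subrr; split=> //.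
    by rewrite !sub0r !subr0 !opprB.
  have a1 := ler_normD ((P n.+1).1 - (P n).1) (P n).1.
  have a2 := ler_normD ((P n.+1).2 - (P n).2) (P n).2.
  rewrite !subrK in a1 a2.
  have IHn : `|(P n.+1).1| + `|(P n.+1).2| <= d - d * 2^-1 ^+ n.+1 by rewrite hS; lra.
  split=> //.
  have n1 := normr_ge0 (P n).1; have n2 := normr_ge0 (P n).2.
  have n3 := normr_ge0 (P n.+1).1; have n4 := normr_ge0 (P n.+1).2.
  have := h0 n; have := h0 n.+1 => h1 h2.
  have [||||e1 e2] := con (P n.+1).1 (P n.+1).2 (P n).1 (P n).2; try lra.
  rewrite hS (P1 n.+1) (P2 n.+1).
  have -> : (P n.+1).1 - (f (P n.+1).1 (P n.+1).2 - c1) - (P n.+1).1 =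
      - ((f (P n.+1).1 (P n.+1).2 - (P n.+1).1) - (f (P n).1 (P n).2 - (P n).1)).
    by have := P1 n; lra.
  have -> : (P n.+1).2 - (g (P n.+1).1 (P n.+1).2 - c2) - (P n.+1).2 =
      - ((g (P n.+1).1 (P n.+1).2 - (P n.+1).2) - (g (P n).1 (P n).2 - (P n).2)).
    by have := P2 n; lra.
  by rewrite !normrN; lra.
have step1 n : `|(P n.+1).1 - (P n).1| <= d / 2 * 2^-1 ^+ n.
  by have [_] := inv n; have := normr_ge0 ((P n.+1).2 - (P n).2); lra.
have step2 n : `|(P n.+1).2 - (P n).2| <= d / 2 * 2^-1 ^+ n.
  by have [_] := inv n; have := normr_ge0 ((P n.+1).1 - (P n).1); lra.
have [s sP] := geometric_limit step1; have [r rP] := geometric_limit step2.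
have sd : `|s| <= d by have := sP 0%N; rewrite /= subr0 expr0; lra.
have rd : `|r| <= d by have := rP 0%N; rewrite /= subr0 expr0; lra.
have zero (v : R) : (forall n, `|v| <= 3 * d * 2^-1 ^+ n) -> v = 0.
  move=> vn; apply/eqP; rewrite -normr_eq0 eq_le normr_ge0 andbT leNgt.
  apply/negP => v0; have d3 : 0 <= 3 * d by lra.
  have v2 : 0 < `|v| / 2 by lra.
  have [T TP] := half_pow_small d3 v2.
  by have := TP T (leqnn T); have := vn T; lra.
exists s, r; split=> //; apply/eqP; rewrite -subr_eq0; apply/eqP/zero => n.
- have [i1 i2] := inv n; have h := h0 n.
  have n1 := normr_ge0 (P n).1; have n2 := normr_ge0 (P n).2.
  have [||||e1 _] := con s r (P n).1 (P n).2 => //; try lra.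
  rewrite (_ : f s r - c1 = ((f s r - s) - (f (P n).1 (P n).2 - (P n).1)) + (s - (P n).1)
     - ((P n.+1).1 - (P n).1)); last by have := P1 n; lra.
  apply: le_trans (ler_normB _ _) _.
  have := ler_normD ((f s r - s) - (f (P n).1 (P n).2 - (P n).1)) (s - (P n).1).
  have := sP n; have := rP n; have := step1 n; lra.
- have [i1 i2] := inv n; have h := h0 n.
  have n1 := normr_ge0 (P n).1; have n2 := normr_ge0 (P n).2.
  have [||||_ e1] := con s r (P n).1 (P n).2 => //; try lra.
  rewrite (_ : g s r - c2 = ((g s r - r) - (g (P n).1 (P n).2 - (P n).2)) + (r - (P n).2)
     - ((P n.+1).2 - (P n).2)); last by have := P2 n; lra.
  apply: le_trans (ler_normB _ _) _.
  have := ler_normD ((g s r - r) - (g (P n).1 (P n).2 - (P n).2)) (r - (P n).2).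
  have := sP n; have := rP n; have := step2 n; lra.
Qed.

Lemma is_derive_line (R : realType) (q : nat) (f : 'rV[R]_q -> R) (p v : 'rV[R]_q) (s : R) :
  derivable f (p + s *: v) v ->
  is_derive s 1 (fun s => f (p + s *: v)) ('D_v f (p + s *: v)).
Proof.
move=> df.
have E : (fun h : R => h^-1 *: (((fun s => f (p + s *: v)) \o shift s) (h *: 1) - f (p + s *: v)))
       = (fun h : R => h^-1 *: ((f \o shift (p + s *: v)) (h *: v) - f (p + s *: v))).
  apply/funext => h /=; congr (_ *: (f _ - _)).
  by rewrite /= scalerDl [h *: 1]mulr1 addrCA.
by split; [rewrite /derivable E|rewrite /derive E].
Qed.

Lemma increment_near_slope (R : realType) (q : nat) (f : 'rV[R]_q -> R) (p v : 'rV[R]_q)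
    (d e m : R) :
  (forall s, `|s| <= d -> derivable f (p + s *: v) v /\ `|'D_v f (p + s *: v) - m| <= e) ->
  forall s s', `|s| <= d -> `|s'| <= d ->
    `|(f (p + s *: v) - m * s) - (f (p + s' *: v) - m * s')| <= e * `|s - s'|.
Proof.
move=> H; suff wl s s' : s' <= s -> `|s| <= d -> `|s'| <= d ->
    `|(f (p + s *: v) - m * s) - (f (p + s' *: v) - m * s')| <= e * `|s - s'|.
  move=> s s' sd s'd; have [ss|/ltW ss] := leP s' s; first exact: wl.
  by rewrite distrC (distrC s); exact: wl.
move=> ss /ler_normlP[s1 s2] /ler_normlP[s3 s4].
have inside x : s' <= x <= s -> `|x| <= d.
  by move=> /andP[x1 x2]; apply/ler_normlP; split; lra.
have [x||x xs E] := @MVT_segment R (fun s => f (p + s *: v)) (fun s => 'D_v f (p + s *: v)) _ _ ss.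
- rewrite in_itv /= => /andP[x1 x2]; apply: is_derive_line.
  have xs : s' <= x <= s by rewrite !ltW.
  exact: (H x (inside x xs)).1.
- apply: derivable_within_continuous => x; rewrite in_itv /= => xs.
  by have /is_derive_line[] := (H x (inside x xs)).1.
rewrite in_itv /= in xs.
rewrite (_ : _ - _ = ('D_v f (p + x *: v) - m) * (s - s')); last first.
  by rewrite mulrBl -E; ring.
rewrite normrM ler_wpM2r//.
by have [] := H x (inside x xs).
Qed.

Lemma Hmap_derive (R : realType) (q : nat) (A B : 'rV[R]_q -> R) (p v : 'rV[R]_q) :
  differentiable A p -> differentiable B p ->
  'D_v A p = (v *m jacobian (Hmap A B) p) ord0 ord0 /\
  'D_v B p = (v *m jacobian (Hmap A B) p) ord0 ord_max.
Proof.
move=> dA dB.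
have HE : Hmap A B = (fun z => A z *: delta_mx ord0 ord0) + (fun z => B z *: delta_mx ord0 ord_max).
  apply/funext => z; apply/rowP => i; rewrite /Hmap fctE !mxE /=.
  by case: i => [[|[|//]] ?] /=; rewrite ?mulr1 ?mulr0 ?addr0 ?add0r.
have dH : differentiable (Hmap A B) p.
  by rewrite HE; apply: differentiableD; exact: differentiableZl.
have dv : derivable (Hmap A B) p v by exact: diff_derivable.
have := deriveEjacobian v dH; rewrite (derive_mx dv) => <-.
have eA : (fun z => Hmap A B z ord0 ord0) = A by apply/funext => z; rewrite mxE.
have eB : (fun z => Hmap A B z ord0 ord_max) = B by apply/funext => z; rewrite mxE.
by split; [rewrite -[in LHS]eA mxE|rewrite -[in LHS]eB mxE].
Qed.

(** Rank two gives a matrix [P] with [P *m jacobian = 1], so along the two rows of [P] the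
    map [(A, B)] has the identity as derivative at [xi0], and nearly so around it. *)
Lemma image_contains_box (R : realType) (q : nat) (A B : 'rV[R]_q -> R)
    (xi0 : 'rV[R]_q) (K : set 'rV[R]_q) :
  continuously_differentiable_near A xi0 -> continuously_differentiable_near B xi0 ->
  \rank (jacobian (Hmap A B) xi0) = 2%N -> interior K xi0 ->
  exists2 e, 0 < e & forall a b, `|a - A xi0| <= e -> `|b - B xi0| <= e ->
    exists xi, [/\ K xi, A xi = a & B xi = b].
Proof.
move=> cA cB rk Kxi.
have /row_fullP[P PJ] : row_full (jacobian (Hmap A B) xi0) by rewrite /row_full rk.
have [dA ctA] := nbhs_singleton cA; have [dB ctB] := nbhs_singleton cB.
have DA i : 'D_(row i P) A xi0 = (i == ord0)%:R.
  by rewrite (Hmap_derive _ dA dB).1 -row_mul PJ !mxE.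
have DB i : 'D_(row i P) B xi0 = (i == ord_max)%:R.
  by rewrite (Hmap_derive _ dA dB).2 -row_mul PJ !mxE.
have near_slope f i (m : R) : {for xi0, continuous (fun p => 'D_(row i P) f p)} ->
    'D_(row i P) f xi0 = m -> \forall z \near xi0, `|'D_(row i P) f z - m| <= 4^-1.
  move=> /cvgr_dist_le cf <-; have q0 : 0 < 4^-1 :> R by rewrite invr_gt0.
  by near=> z; rewrite distrC; near: z; exact: cf.
pose good z := [/\ K z, differentiable A z, differentiable B z &
  forall i, `|'D_(row i P) A z - (i == ord0)%:R| <= 4^-1 /\
            `|'D_(row i P) B z - (i == ord_max)%:R| <= 4^-1].
have : \forall z \near xi0, good z.
  have a0 := near_slope A ord0 _ (ctA _) (DA _).
  have a1 := near_slope A ord_max _ (ctA _) (DA _).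
  have b0 := near_slope B ord0 _ (ctB _) (DB _).
  have b1 := near_slope B ord_max _ (ctB _) (DB _).
  near=> z; split; [by near: z| | |].
  - by have [] : differentiable A z /\ forall v, {for z, continuous (fun p => 'D_v A p)} by near: z.
  - by have [] : differentiable B z /\ forall v, {for z, continuous (fun p => 'D_v B p)} by near: z.
  - move=> i; have [->|->] : i = ord0 \/ i = ord_max.
      by case: i => [[|[|//]] ?]; [left|right]; apply/val_inj.
    + by split; near: z.
    + by split; near: z.
move=> /nbhs_ballP[eps /= eps0 epsP].
set v0 := row ord0 P; set v1 := row ord_max P.
pose N := `|v0| + `|v1| + 1.
have N0 : 0 < N by rewrite /N ltr_wpDl// addr_ge0.
pose d := eps / N / 2.
have d0 : 0 < d by rewrite /d !divr_gt0.
have inball s r : `|s| <= d -> `|r| <= d -> good (xi0 + s *: v0 + r *: v1).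
  move=> sd rd; apply: epsP; rewrite -ball_normE /ball_ /= -addrA opprD addNKr normrN.
  apply: le_lt_trans (ler_normD _ _) _; rewrite !normrZ.
  have h1 : `|s| * `|v0| <= d * `|v0| by rewrite ler_wpM2r.
  have h2 : `|r| * `|v1| <= d * `|v1| by rewrite ler_wpM2r.
  have : d * N < eps by rewrite /d mulrAC divfK ?gt_eqF//; lra.
  rewrite /N; lra.
pose f s r := A (xi0 + s *: v0 + r *: v1); pose g s r := B (xi0 + s *: v0 + r *: v1).
have swap s r : xi0 + s *: v0 + r *: v1 = xi0 + r *: v1 + s *: v0 by rewrite addrAC.
exists (d / 4); first by rewrite divr_gt0.
move=> a b ea eb.
have [||s [r [sd rd fa gb]]] := @near_identity_onto R f g d a b d0.
- move=> s r s' r' sd rd s'd r'd.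
  have f1 := @increment_near_slope R q A (xi0 + r *: v1) v0 d 4^-1 1 _ s s' sd s'd.
  have f2 := @increment_near_slope R q A (xi0 + s' *: v0) v1 d 4^-1 0 _ r r' rd r'd.
  have g1 := @increment_near_slope R q B (xi0 + r *: v1) v0 d 4^-1 0 _ s s' sd s'd.
  have g2 := @increment_near_slope R q B (xi0 + s' *: v0) v1 d 4^-1 1 _ r r' rd r'd.
  rewrite /f /g; split.
    rewrite (_ : _ - _ = ((A (xi0 + r *: v1 + s *: v0) - 1 * s) - (A (xi0 + r *: v1 + s' *: v0) - 1 * s'))
      + ((A (xi0 + s' *: v0 + r *: v1) - 0 * r) - (A (xi0 + s' *: v0 + r' *: v1) - 0 * r'))).
      apply: le_trans (ler_normD _ _) _; rewrite mulrDl ![_ / 4]mulrC; apply: lerD.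
        apply: f1 => x xd; rewrite -swap; have [_ dAx _ /(_ ord0)[? _]] := inball x r xd rd.
        by split=> //; exact: diff_derivable.
      apply: f2 => x xd; have [_ dAx _ /(_ ord_max)[? _]] := inball s' x s'd xd.
      by split=> //; exact: diff_derivable.
    by rewrite -!swap; ring.
  rewrite (_ : _ - _ = ((B (xi0 + r *: v1 + s *: v0) - 0 * s) - (B (xi0 + r *: v1 + s' *: v0) - 0 * s'))
    + ((B (xi0 + s' *: v0 + r *: v1) - 1 * r) - (B (xi0 + s' *: v0 + r' *: v1) - 1 * r'))).
    apply: le_trans (ler_normD _ _) _; rewrite mulrDl ![_ / 4]mulrC; apply: lerD.
      apply: g1 => x xd; rewrite -swap; have [_ _ dBx /(_ ord0)[_ ?]] := inball x r xd rd.
      by split=> //; exact: diff_derivable.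
    apply: g2 => x xd; have [_ _ dBx /(_ ord_max)[_ ?]] := inball s' x s'd xd.
    by split=> //; exact: diff_derivable.
  by rewrite -!swap; ring.
- by rewrite /f /g !scale0r !addr0; lra.
exists (xi0 + s *: v0 + r *: v1); split=> //.
by have [] := inball s r sd rd.
Unshelve. all: by end_near. Qed.

(** * Robust stabilizability *)

(** Moving inside the box one may assume a nonzero coefficient and an exponent strictly
    above the critical one; in logarithmic coordinates a smaller box then fits. *)
Lemma box_not_stabilizable (R : realType) (W : R) (q : nat) (g0 : R -> R)
    (A B : 'rV[R]_q -> R) (K : set 'rV[R]_q) (a0 b0 e : R) :
  0 < W -> 0 < e -> 3 * Num.sqrt 3 / 2 <= b0 ->
  (forall a b, `|a - a0| <= e -> `|b - b0| <= e -> exists xi, [/\ K xi, A xi = a & B xi = b]) ->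
  ~ robustly_stabilizable W g0 A B K.
Proof.
move=> W0 e0 sup onto [mu stab].
have [a1 a1n0 a1a0] : exists2 a1, a1 != 0 & `|a1 - a0| <= e / 2.
  have [->|a0n0] := eqVneq a0 0.
    by exists (e / 2); rewrite ?gt_eqF ?divr_gt0// subr0 ger0_norm//; lra.
  by exists a0; rewrite // subrr normr0; lra.
have na1 : 0 < `|a1| by rewrite normr_gt0.
pose L := expR (ln `|a1| + 1); have L0 : 0 < L := expR_gt0 _.
(* r <= e / 2 / L keeps the coefficients within e / 2 of a1, since e^z has slope at
   most L there; r <= e / 6 keeps the exponents supercritical. *)
pose r := Num.min 1 (Num.min (e / 6) (e / 2 / L)).
have r0 : 0 < r by rewrite !lt_min ltr01 !divr_gt0.
have [r1 [r2 r3]] : r <= 1 /\ r <= e / 6 /\ r <= e / 2 / L.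
  by rewrite /r !ge_min !lexx !orbT.
pose u : law R := fun y t => g0 (y t) + mu t (\row_(i < t.+1) y i).
have cu : causal u.
  move=> y y' t yy'; rewrite /u yy'//; congr (_ + mu t _).
  by apply/rowP => i; rewrite !mxE yy'// -ltnS.
have kap : `|Num.sg a1| = 1 by rewrite normr_sg a1n0.
have sup' : Num.sqrt 3 + 2 * r <= 2 / 3 * (b0 + e / 2) by lra.
have [al [be [y [alr ber tr unb]]]] := adversary_wins (ln `|a1|) W0 r0 sup' kap cu.
have [||xi [Kxi Axi Bxi]] := onto (Num.sg a1 * expR al) be.
- have eL z : z <= ln `|a1| + r -> expR z <= L by move=> h; rewrite ler_expR; lra.
  have near z z' : z <= ln `|a1| + r -> `|z - z'| <= r -> expR z - expR z' <= e / 2.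
    move=> zr zz'; apply: le_trans (expR_sub_le _ _) _.
    apply: (@le_trans _ _ (`|z - z'| * expR z)); first by rewrite ler_wpM2r ?expR_ge0// ler_norm.
    apply: (@le_trans _ _ (r * L)); first by rewrite ler_pM ?expR_ge0// eL.
    by rewrite -ler_pdivlMr.
  have da : `|Num.sg a1 * expR al - a1| <= e / 2.
    rewrite {2}[a1]numEsg -mulrBr normrM kap mul1r -{1}(lnK na1).
    move: (alr) => /ler_normlP[h1 h2].
    apply/ler_normlP; split; last by apply: near => //; lra.
    by rewrite opprB; apply: near; [lra|rewrite distrC].
  rewrite (_ : _ - a0 = (Num.sg a1 * expR al - a1) + (a1 - a0)); last by ring.
  by apply: le_trans (ler_normD _ _) _; lra.
- rewrite (_ : _ - b0 = (be - (b0 + e / 2)) + e / 2); last by ring.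
  by apply: le_trans (ler_normD _ _) _; rewrite (ger0_norm (_ : 0 <= e / 2)); lra.
pose w t := if t is s.+1 then
  y s.+1 - (g0 (y s) + A xi * phi (B xi) (y s) + mu s (\row_(i < s.+1) y i)) else 0.
have [|t|V ubV] := stab xi w y Kxi.
- move=> [//|s] _; rewrite /w Axi Bxi.
  have := tr s.+1 s (ltnSn s); rewrite /u.
  by congr (`|_| <= W); ring.
- by rewrite /w; ring.
have [t Vt] := unb V.
by have := ubV _ (ex_intro2 _ _ t I erefl); rewrite leNgt Vt.
Qed.

Theorem corollary3p7 (R : realType) (W : R) (W_gt0 : 0 < W) (q : nat)
    (Xi : set 'rV[R]_q) (Xi_neq0 : Xi !=set0) (Xi_compact : compact Xi)
    (g0 : R -> R) (A B : 'rV[R]_q -> R)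
    (B_gt0 : forall xi : 'rV[R]_q, Xi xi -> 0 < B xi)
    (A_cont : {within Xi, continuous A}) (B_cont : {within Xi, continuous B}) :
  [/\ (* (i) *)
      sup (B @` Xi) <= 3 * Num.sqrt 3 / 2 ->
        robustly_stabilizable W g0 A B Xi /\
        uniformly_robustly_stabilizable W g0 A B Xi,
      (* (ii) *)
      forall xi0 : 'rV[R]_q, interior Xi xi0 ->
        continuously_differentiable_near A xi0 ->
        continuously_differentiable_near B xi0 ->
        \rank (jacobian (Hmap A B) xi0) = 2%N ->
        3 * Num.sqrt 3 / 2 <= B xi0 ->
        ~ exists K : set 'rV[R]_q,
            [/\ compact K, K `<=` Xi, interior K xi0 &
                robustly_stabilizable W g0 A B K]
    & (* (iii) *)
      finite_set (B @` Xi) -> sup (B @` Xi) < 4 ->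
        robustly_stabilizable W g0 A B Xi /\
        uniformly_robustly_stabilizable W g0 A B Xi].
Proof.
have [M M0 AM] := within_compact_bounded Xi_compact A_cont.
have [N N0 BN] := within_compact_bounded Xi_compact B_cont.
have Bsup xi : Xi xi -> B xi <= sup (B @` Xi).
  move=> Xxi; apply: ub_le_sup; last by exists xi.
  by exists N => _ [xi' Xxi' <-]; apply: le_trans (ler_norm _) (BN _ Xxi').
have W0 := ltW W_gt0.
have s3 := sqrt3_ge R; have ss3 := sqrt3_sqr R.
split.
- move=> Bcrit; pose bm : R := 3 * Num.sqrt 3 / 2.
  apply: (stabilizing_feedback _ (Fs := power_class M [set b | 0 < b <= bm])).
    move=> xi Xxi; exists (A xi), (B xi); split=> //=; first exact: AM.
    by rewrite B_gt0// (le_trans (Bsup _ Xxi)).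
  have bm2 : 4 * bm ^+ 2 = 27.
    by rewrite /bm !exprMn exprVn ss3; field.
  move=> Y; apply: critical_stabilizable => //; rewrite ?bm2//.
    by rewrite /bm; lra.
  by rewrite ltNge; apply/negP => h; nra.
- move=> xi0 _ cA cB rk Bcrit [K [_ _ Kxi0]].
  have [e e0 box] := image_contains_box cA cB rk Kxi0.
  exact: box_not_stabilizable W_gt0 e0 Bcrit box.
- move=> finB B4.
  apply: (stabilizing_feedback _ (Fs := power_class M (B @` Xi))).
    by move=> xi Xxi; exists (A xi), (B xi); split=> //; exact: AM.
  move=> Y; apply: finite_exponents_stabilizable => // _ [xi Xxi <-].
  by rewrite B_gt0// (le_lt_trans (Bsup _ Xxi)).
Qed.
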